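(* Over $\mathsf{RCA}_0$ the following are equivalent: (i) $\mathsf{WKL}_0$ (i.e. Weak König's Lemma); (ii) every partial order is a 1-1 interval order if and only if it does not contain $\mathbf{2}\oplus\mathbf{2}$; (iii) every partial order is a closed interval order if and only if it does not contain $\mathbf{2}\oplus\mathbf{2}$; (iv) every partial order is a 1-1 closed interval order if and only if it does not contain $\mathbf{2}\oplus\mathbf{2}$; (v) every partial order is a distinguishing interval order if and only if it does not contain $\mathbf{2}\oplus\mathbf{2}$.
   Context: $\mathsf{RCA}_0$ is the base subsystem of second-order arithmetic ($\Delta^0_1$ comprehension, $\Sigma^0_1$ induction); $\mathsf{WKL}_0$ is $\mathsf{RCA}_0$ plus Weak König's Lemma (every infinite tree of finite $0$-$1$ sequences has an infinite path). A partial order $\mathbf{P}=(P,\leq_P)$ is a set $P\subseteq\mathbb{N}$ with a reflexive, transitive, antisymmetric relation $\leq_P$; a linear order has any two elements comparable; $p<_P q$ means $p\leq_P q$ and $p\ne q$. $\mathbf{P}$ is an interval order if there are a linear order $\mathbf{L}=(L,\leq_L)$ and $F\subseteq P\times L$ such that, with $F(p)=\{x\in L:(p,x)\in F\}$: (i1) each $F(p)$ is nonempty and convex ($x,y\in F(p)$, $x<_L z<_L y$ imply $z\in F(p)$); (i2) $p<_P q$ iff $x<_L y$ for all $x\in F(p),y\in F(q)$. It is a 1-1 interval order if moreover (i3) $F(p)\neq F(q)$ whenever $p\neq q$. $\mathbf{P}$ is a closed interval order if there are a linear order $\mathbf{L}$ and functions $f_0,f_1:P\to L$ with (c1) $f_0(p)\leq_L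 f_1(p)$ for all $p$; (c2) $p<_P q$ iff $f_1(p)<_L f_0(q)$. It is a 1-1 closed interval order if moreover (c3) $f_0(p)\ne f_0(q)$ or $f_1(p)\ne f_1(q)$ whenever $p\ne q$; it is a distinguishing interval order if (c1),(c2) hold and (c4) $f_i(p)\ne f_j(q)$ whenever $p\ne q$ or $i\ne j$ ($i,j\in\{0,1\}$). $\mathbf{P}$ does not contain $\mathbf{2}\oplus\mathbf{2}$ if for all $p_0,q_0,p_1,q_1\in P$, $p_0<_P q_0$ and $p_1<_P q_1$ imply $p_0\leq_P q_1$ or $p_1\leq_P q_0$. *)

(* Defs.v *)
(** Second-order arithmetic is treated through its Henkin structures: numbers
    and sets are two arbitrary nonempty sorts, so the numbers may be nonstandard
    and the sets need not be all subsets.  "Over a theory" means "in every model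
    of the theory", which by the completeness theorem is provability.  Equality
    of sets is not primitive. *)

Set Implicit Arguments.
Unset Strict Implicit.

Record L2_structure := L2Structure {
  num : Type;
  sets : Type;
  zero : num;
  one : num;
  add : num -> num -> num;
  mul : num -> num -> num;
  lt : num -> num -> Prop;
  mem : num -> sets -> Prop;
  sets_inhabited : inhabited sets
}.

Arguments zero {M} : rename.
Arguments one {M} : rename.
Arguments add {M} : rename.
Arguments mul {M} : rename.
Arguments lt {M} : rename.
Arguments mem {M} : rename.

Declare Scope l2_scope.
Delimit Scope l2_scope with l2.
Notation "x + y" := (add x y) : l2_scope.
Notation "x * y" := (mul x y) : l2_scope.
Notation "x < y" := (lt x y) : l2_scope.
Notation "x ∈ X" := (mem x X) (at level 70, no associativity) : l2_scope.
Local Open Scope l2_scope.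

(** ** Bounded quantifier formulas with number and set parameters

    Number variables are de Bruijn indices.  Set variables are never bound.  In
    [BAll t f] and [BEx t f] the term [t] lives outside the binder, hence it
    cannot mention the variable bound in [f]. *)

Inductive term :=
| Var (i : nat)
| Zero
| One
| Add (s t : term)
| Mul (s t : term).

Inductive bounded_formula :=
| Eq (s t : term)
| Lt (s t : term)
| In (t : term) (X : nat)
| Not (f : bounded_formula)
| And (f g : bounded_formula)
| Or (f g : bounded_formula)
| Imp (f g : bounded_formula)
| BAll (t : term) (f : bounded_formula)
| BEx (t : term) (f : bounded_formula).

Definition scons (A : Type) (a : A) (e : nat -> A) (i : nat) : A :=
  match i with O => a | S j => e j end.

Fixpoint eval (M : L2_structure) (e : nat -> num M) (t : term) : num M :=
  match t with
  | Var i => e i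
  | Zero => zero
  | One => one
  | Add s t => eval e s + eval e t
  | Mul s t => eval e s * eval e t
  end.

Fixpoint sat (M : L2_structure) (e : nat -> num M) (E : nat -> sets M)
    (f : bounded_formula) : Prop :=
  match f with
  | Eq s t => eval e s = eval e t
  | Lt s t => eval e s < eval e t
  | In t X => eval e t ∈ E X
  | Not f => ~ sat e E f
  | And f g => sat e E f /\ sat e E g
  | Or f g => sat e E f \/ sat e E g
  | Imp f g => sat e E f -> sat e E g
  | BAll t f => forall n, n < eval e t -> sat (scons n e) E f
  | BEx t f => exists n, n < eval e t /\ sat (scons n e) E f
  end.

Definition Sigma01 (M : L2_structure) (A : num M -> Prop) : Prop :=
  exists (f : bounded_formula) (e : nat -> num M) (E : nat -> sets M),
    forall n, A n <-> exists m, sat (scons m (scons n e)) E f.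

Definition Pi01 (M : L2_structure) (A : num M -> Prop) : Prop :=
  exists (f : bounded_formula) (e : nat -> num M) (E : nat -> sets M),
    forall n, A n <-> forall m, sat (scons m (scons n e)) E f.

(** ** The axioms of RCA_0 *)

Definition basic_axioms (M : L2_structure) : Prop :=
  (forall n : num M, n + one <> zero) /\
  (forall m n : num M, m + one = n + one -> m = n) /\
  (forall m : num M, m + zero = m) /\
  (forall m n : num M, m + (n + one) = (m + n) + one) /\
  (forall m : num M, m * zero = zero) /\
  (forall m n : num M, m * (n + one) = m * n + m) /\
  (forall m : num M, ~ m < zero) /\
  (forall m n : num M, m < n + one <-> m < n \/ m = n).

Definition Sigma01_induction (M : L2_structure) : Prop :=
  forall A : num M -> Prop, Sigma01 A ->
    A zero -> (forall n, A n -> A (n + one)) -> forall n, A n.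

Definition Delta01_comprehension (M : L2_structure) : Prop :=
  forall A : num M -> Prop, Sigma01 A -> Pi01 A ->
    exists X : sets M, forall n, n ∈ X <-> A n.

Definition RCA0 (M : L2_structure) : Prop :=
  basic_axioms M /\ Sigma01_induction M /\ Delta01_comprehension M.

(** ** Pairs, relations and functions *)

Definition pair (M : L2_structure) (i j : num M) : num M :=
  (i + j) * (i + j) + i.

Definition rel (M : L2_structure) (R : sets M) (i j : num M) : Prop :=
  pair i j ∈ R.

Definition rel_on (M : L2_structure) (R X Y : sets M) : Prop :=
  forall n, n ∈ R -> exists i j, i ∈ X /\ j ∈ Y /\ n = pair i j.

(** [rel f p x] reads "f(p) = x" when [f] is a function. *)
Definition function (M : L2_structure) (f X Y : sets M) : Prop :=
  rel_on f X Y /\ forall p, p ∈ X -> exists! x, rel f p x.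

(** ** Finite sequences

    The triple [((k, m), n)] represents the finite set of all [i < k] such that
    [m (i + 1) + 1] divides [n]; the code of a finite set is the least number
    representing it.  A finite sequence of length [l] is (the code of) a finite
    set of pairs which is a function with domain [{i | i < l}]. *)

Definition triple (M : L2_structure) (c : num M) : Prop :=
  exists k m n, c = pair (pair k m) n.

Definition fin_mem (M : L2_structure) (i c : num M) : Prop :=
  exists k m n, c = pair (pair k m) n /\ i < k /\
    exists q, n = q * (m * (i + one) + one).

Definition fin_code (M : L2_structure) (c : num M) : Prop :=
  triple c /\
  forall d, d < c -> triple d -> ~ forall i, fin_mem i d <-> fin_mem i c.

(** [entry s i j] reads "s(i) = j". *)
Definition entry (M : L2_structure) (s i j : num M) : Prop :=
  fin_mem (pair i j) s.

Definition seq_length (M : L2_structure) (s l : num M) : Prop :=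
  fin_code s /\
  (forall x, fin_mem x s -> exists i j, i < l /\ x = pair i j) /\
  (forall i, i < l -> exists! j, entry s i j).

Definition binary_seq (M : L2_structure) (s : num M) : Prop :=
  exists l, seq_length s l /\
    forall i j, entry s i j -> j = zero \/ j = one.

Definition initial_segment (M : L2_structure) (t s : num M) : Prop :=
  exists l k, seq_length t l /\ seq_length s k /\ (l < k \/ l = k) /\
    forall i j, i < l -> (entry t i j <-> entry s i j).

(** ** Weak König's Lemma *)

Definition binary_tree (M : L2_structure) (T : sets M) : Prop :=
  (forall s, s ∈ T -> binary_seq s) /\
  (forall s t, s ∈ T -> initial_segment t s -> t ∈ T).

Definition infinite (M : L2_structure) (X : sets M) : Prop :=
  forall k, exists n, n ∈ X /\ (k < n \/ k = n).

(** [f] is a function from the numbers to [{0, 1}] all of whose finite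
    restrictions belong to [T]. *)
Definition infinite_path (M : L2_structure) (f T : sets M) : Prop :=
  (forall x, x ∈ f -> exists i j, (j = zero \/ j = one) /\ x = pair i j) /\
  (forall i, exists! j, rel f i j) /\
  (forall n, exists s, s ∈ T /\ seq_length s n /\
     forall i j, i < n -> (entry s i j <-> rel f i j)).

Definition WKL (M : L2_structure) : Prop :=
  forall T : sets M, binary_tree T -> infinite T ->
    exists f : sets M, infinite_path f T.

(** ** Orders *)

Definition partial_order (M : L2_structure) (P le : sets M) : Prop :=
  rel_on le P P /\
  (forall p, p ∈ P -> rel le p p) /\
  (forall p q r, rel le p q -> rel le q r -> rel le p r) /\
  (forall p q, rel le p q -> rel le q p -> p = q).

Definition linear_order (M : L2_structure) (L le : sets M) : Prop :=
  partial_order L le /\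
  (forall x y, x ∈ L -> y ∈ L -> rel le x y \/ rel le y x).

Definition strict (M : L2_structure) (le : sets M) (p q : num M) : Prop :=
  rel le p q /\ p <> q.

Definition omits_2_plus_2 (M : L2_structure) (P le : sets M) : Prop :=
  forall p0 q0 p1 q1, p0 ∈ P -> q0 ∈ P -> p1 ∈ P -> q1 ∈ P ->
    strict le p0 q0 -> strict le p1 q1 -> rel le p0 q1 \/ rel le p1 q0.

(** ** Interval orders; [rel F p x] reads "x belongs to F(p)" *)

Definition interval_rep (M : L2_structure) (P leP L leL F : sets M) : Prop :=
  linear_order L leL /\ rel_on F P L /\
  (forall p, p ∈ P ->
     (exists x, rel F p x) /\
     (forall x y z, rel F p x -> rel F p y ->
        strict leL x z -> strict leL z y -> rel F p z)) /\
  (forall p q, p ∈ P -> q ∈ P ->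
     (strict leP p q <->
      forall x y, rel F p x -> rel F q y -> strict leL x y)).

Definition one_one_interval_order (M : L2_structure) (P leP : sets M) : Prop :=
  exists L leL F, interval_rep P leP L leL F /\
    forall p q, p ∈ P -> q ∈ P -> p <> q ->
      ~ forall x, rel F p x <-> rel F q x.

Definition closed_rep (M : L2_structure) (P leP L leL f0 f1 : sets M) : Prop :=
  linear_order L leL /\ function f0 P L /\ function f1 P L /\
  (forall p x0 x1, p ∈ P -> rel f0 p x0 -> rel f1 p x1 -> rel leL x0 x1) /\
  (forall p q x1 y0, p ∈ P -> q ∈ P -> rel f1 p x1 -> rel f0 q y0 ->
     (strict leP p q <-> strict leL x1 y0)).

Definition closed_interval_order (M : L2_structure) (P leP : sets M) : Prop :=
  exists L leL f0 f1, closed_rep P leP L leL f0 f1.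

Definition one_one_closed_interval_order (M : L2_structure) (P leP : sets M)
    : Prop :=
  exists L leL f0 f1, closed_rep P leP L leL f0 f1 /\
    forall p q x0 x1 y0 y1, p ∈ P -> q ∈ P -> p <> q ->
      rel f0 p x0 -> rel f1 p x1 -> rel f0 q y0 -> rel f1 q y1 ->
      x0 <> y0 \/ x1 <> y1.

Definition distinguishing_interval_order (M : L2_structure) (P leP : sets M)
    : Prop :=
  exists L leL f0 f1, closed_rep P leP L leL f0 f1 /\
    let f (i : bool) := if i then f1 else f0 in
    forall (i j : bool) p q x y, p ∈ P -> q ∈ P -> p <> q \/ i <> j ->
      rel (f i) p x -> rel (f j) q y -> x <> y.

Definition characterized_by_omitting_2_plus_2 (M : L2_structure)
    (C : sets M -> sets M -> Prop) : Prop :=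
  forall P le : sets M, partial_order P le ->
    (C P le <-> omits_2_plus_2 P le).

(* Main.v *)
(** Everything goes through the separation of disjoint Sigma01 classes.

    Weak König's Lemma gives separation by means of the tree of all partial
    separators.  Conversely, let a separating set decide, for every binary
    sequence [s], between "the successor [s1] has no extension in [T] at a level
    where [s0] has one" and the same with [0] and [1] exchanged; following its
    decisions never leaves an infinite binary tree [T].

    If P omits 2+2, the comparisons between left and right endpoints forced by
    P generate a strict weak order [prec] on all endpoints.  Its failure to be
    decidable is repaired by a set separating [prec] from its converse, which
    yields a tournament [below] extending [prec].  If [prec a b], then
    [below m a] implies [below m b] for every [m]; hence comparing
    lexicographically the sets [{m | below m a}] gives a linear order that
    extends [prec], without any recursion.

    For the reversals, elements [a n] and [b n] of a partial order omitting 2+2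
    are such that enumerating [n] in one of two disjoint Sigma01 classes forces
    the interval of [a n] to be shifted, at both ends, to the left or to the
    right of that of [b n].  In a representation by closed intervals, or by
    pairwise distinct intervals, one can find effectively a direction in which
    the interval of [a n] may be shifted, and these directions form a separating
    set. *)

From Stdlib Require Import Classical Lia Arith Ring Morphisms.
Require Import Defs.

Local Set Implicit Arguments.
Local Unset Strict Implicit.
Local Open Scope l2_scope.
Local Notation "x ≤ y" := (lt x (add y one)) (at level 70) : l2_scope.

(** * Definability *)

Fixpoint tsubst (s : nat -> term) (t : term) : term :=
  match t with
  | Var i => s i
  | Zero => Zero
  | One => One
  | Add t u => Add (tsubst s t) (tsubst s u)
  | Mul t u => Mul (tsubst s t) (tsubst s u)
  end.

Definition up (s : nat -> term) (i : nat) : term :=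
  match i with O => Var 0 | S j => tsubst (fun k => Var (S k)) (s j) end.

Fixpoint subst (s : nat -> term) (r : nat -> nat) (f : bounded_formula)
    : bounded_formula :=
  match f with
  | Eq t u => Eq (tsubst s t) (tsubst s u)
  | Lt t u => Lt (tsubst s t) (tsubst s u)
  | In t X => In (tsubst s t) (r X)
  | Not f => Not (subst s r f)
  | And f g => And (subst s r f) (subst s r g)
  | Or f g => Or (subst s r f) (subst s r g)
  | Imp f g => Imp (subst s r f) (subst s r g)
  | BAll t f => BAll (tsubst s t) (subst (up s) r f)
  | BEx t f => BEx (tsubst s t) (subst (up s) r f)
  end.

Section Definability.

Context {M : L2_structure}.

Lemma eval_tsubst (e e' : nat -> num M) s t :
  (forall i, eval e' (s i) = e i) -> eval e' (tsubst s t) = eval e t.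
Proof.
  intros H; induction t; simpl; congruence.
Qed.

Lemma sat_subst f : forall (e e' : nat -> num M) E E' s r,
  (forall i, eval e' (s i) = e i) -> (forall X, E' (r X) = E X) ->
  (sat e' E' (subst s r f) <-> sat e E f).
Proof.
  induction f; intros e e' E E' s' r He HE; simpl;
    rewrite ?(eval_tsubst _ He), ?HE;
    try solve [reflexivity | rewrite ?(IHf e e' E E'), ?(IHf1 e e' E E'),
      ?(IHf2 e e' E E') by assumption; reflexivity].
  all: assert (Hup : forall n i, eval (scons n e') (up s' i) = scons n e i)
    by (intros n [|i]; simpl; [reflexivity |];
        rewrite (eval_tsubst (e := e')); auto).
  all: split.
  - intros H n Hn. apply (IHf _ _ _ _ _ _ (Hup n) HE); auto.
  - intros H n Hn. apply (IHf _ _ _ _ _ _ (Hup n) HE); auto.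
  - intros (n & Hn & H). exists n; split; [auto |].
    apply (IHf _ _ _ _ _ _ (Hup n) HE); auto.
  - intros (n & Hn & H). exists n; split; [auto |].
    apply (IHf _ _ _ _ _ _ (Hup n) HE); auto.
Qed.

(* A context assigns values to [n] variables; the last component is the variable
   of de Bruijn index [0].  The variables from [n] on serve as number parameters
   of the formula. *)
Fixpoint ctx (n : nat) : Type :=
  match n with O => unit | S n => (ctx n * num M)%type end.

Fixpoint env (n : nat) : ctx n -> (nat -> num M) -> nat -> num M :=
  match n with
  | O => fun _ p => p
  | S n => fun c p => scons (snd c) (env (fst c) p)
  end.

(** Parameters are kept apart from the context, so that definability becomes a property of
    predicates on contexts. The closure lemmas below then build the formulas, which need not be
    written out. *)
Record params := Params { pnum : nat -> num M; psets : nat -> sets M }.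

Definition is_tm (a : params) n (t : ctx n -> num M) : Prop :=
  exists u, forall c, t c = eval (env c (pnum a)) u.

Definition is_d0 (a : params) n (P : ctx n -> Prop) : Prop :=
  exists f, forall c, P c <-> sat (env c (pnum a)) (psets a) f.

Definition tm n (t : ctx n -> num M) : Prop := exists a, is_tm a t.
Definition d0 n (P : ctx n -> Prop) : Prop := exists a, is_d0 a P.
Definition s1 n (P : ctx n -> Prop) : Prop :=
  exists Q : ctx (S n) -> Prop, d0 Q /\ forall c, P c <-> exists x, Q (c, x).

(** Two formulas come with unrelated parameter assignments. Placing one at the even and the other at
    the odd indices lets a connective join them under a single assignment. *)
Definition interleave (A : Type) (p q : nat -> A) (i : nat) : A :=
  if Nat.even i then p (Nat.div2 i) else q (Nat.div2 i).

Lemma interleave_l A (p q : nat -> A) i : interleave p q (2 * i)%nat = p i.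
Proof.
  unfold interleave. rewrite Nat.even_mul, Nat.div2_double. reflexivity.
Qed.

Lemma interleave_r A (p q : nat -> A) i : interleave p q (S (2 * i)%nat) = q i.
Proof.
  unfold interleave.
  rewrite Nat.even_succ, Nat.odd_mul, Nat.div2_succ_double. reflexivity.
Qed.

Definition merge (a b : params) : params :=
  Params (interleave (pnum a) (pnum b)) (interleave (psets a) (psets b)).

Lemma env_tail n (c : ctx n) p i : env c p (n + i)%nat = p i.
Proof.
  revert c; induction n as [|n IH]; intros c; simpl; auto.
Qed.

Lemma env_head n (c : ctx n) p q i : (i < n)%nat -> env c p i = env c q i.
Proof.
  revert c i; induction n as [|n IH]; intros c [|i] Hi; simpl; try lia; auto.
  apply IH; lia.
Qed.

Definition reindex (n : nat) (r : nat -> nat) (i : nat) : term :=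
  if Nat.ltb i n then Var i else Var (n + r (i - n))%nat.

Lemma eval_reindex n (c : ctx n) p q r i :
  (forall j, q (r j) = p j) -> eval (env c q) (reindex n r i) = env c p i.
Proof.
  intros H. unfold reindex. destruct (Nat.ltb_spec i n) as [L|L]; simpl.
  - apply env_head; auto.
  - rewrite env_tail, H. replace i with (n + (i - n))%nat at 2 by lia.
    rewrite env_tail. reflexivity.
Qed.

Lemma is_tm_l a b n (t : ctx n -> num M) : is_tm a t -> is_tm (merge a b) t.
Proof.
  intros [u Hu]. exists (tsubst (reindex n (fun i => 2 * i)%nat) u). intros c.
  rewrite Hu. symmetry. apply eval_tsubst. intros i. apply eval_reindex.
  apply interleave_l.
Qed.

Lemma is_tm_r a b n (t : ctx n -> num M) : is_tm b t -> is_tm (merge a b) t.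
Proof.
  intros [u Hu]. exists (tsubst (reindex n (fun i => S (2 * i)%nat)) u). intros c.
  rewrite Hu. symmetry. apply eval_tsubst. intros i. apply eval_reindex.
  apply interleave_r.
Qed.

Lemma is_d0_l a b n (P : ctx n -> Prop) : is_d0 a P -> is_d0 (merge a b) P.
Proof.
  intros [f Hf].
  exists (subst (reindex n (fun i => 2 * i)%nat) (fun i => 2 * i)%nat f). intros c.
  rewrite Hf. symmetry. apply sat_subst.
  - intros i. apply eval_reindex. apply interleave_l.
  - apply interleave_l.
Qed.

Lemma is_d0_r a b n (P : ctx n -> Prop) : is_d0 b P -> is_d0 (merge a b) P.
Proof.
  intros [f Hf].
  exists (subst (reindex n (fun i => S (2 * i)%nat)) (fun i => S (2 * i)%nat) f).
  intros c. rewrite Hf. symmetry. apply sat_subst.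
  - intros i. apply eval_reindex. apply interleave_r.
  - apply interleave_r.
Qed.

Lemma tm_var n : tm (fun c : ctx (S n) => snd c).
Proof.
  destruct (sets_inhabited M) as [X].
  exists (Params (fun _ => zero) (fun _ => X)), (Var 0). reflexivity.
Qed.

Lemma tm_const n x : tm (fun _ : ctx n => x).
Proof.
  destruct (sets_inhabited M) as [X].
  exists (Params (fun _ => x) (fun _ => X)), (Var (n + 0)%nat). intros c. simpl.
  rewrite env_tail. reflexivity.
Qed.

Lemma tm_weaken n (t : ctx n -> num M) :
  tm t -> tm (fun c : ctx (S n) => t (fst c)).
Proof.
  intros [a [u Hu]]. exists a, (tsubst (fun i => Var (S i)) u). intros c.
  rewrite Hu. symmetry. apply eval_tsubst. reflexivity.
Qed.

Lemma tm_op (op : num M -> num M -> num M) (Op : term -> term -> term) n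
    (t u : ctx n -> num M) :
  (forall e s s', eval e (Op s s') = op (eval e s) (eval e s')) ->
  tm t -> tm u -> tm (fun c => op (t c) (u c)).
Proof.
  intros H [a Ht] [b Hu].
  destruct (is_tm_l b Ht) as [t' Ht'], (is_tm_r a Hu) as [u' Hu'].
  exists (merge a b), (Op t' u'). intros c. rewrite H, Ht', Hu'. reflexivity.
Qed.

Lemma tm_add n (t u : ctx n -> num M) :
  tm t -> tm u -> tm (fun c => t c + u c).
Proof. apply (tm_op (Op := Add)). reflexivity. Qed.

Lemma tm_mul n (t u : ctx n -> num M) :
  tm t -> tm u -> tm (fun c => t c * u c).
Proof. apply (tm_op (Op := Mul)). reflexivity. Qed.

(** * Closure properties of bounded definability *)

Lemma d0_ext n (Q P : ctx n -> Prop) :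
  (forall c, P c <-> Q c) -> d0 Q -> d0 P.
Proof.
  intros H [a [f Hf]]. exists a, f. intros c. rewrite H. apply Hf.
Qed.

Lemma d0_atom (R : num M -> num M -> Prop) (Op : term -> term -> bounded_formula)
    n (t u : ctx n -> num M) :
  (forall e E s s', sat e E (Op s s') <-> R (eval e s) (eval e s')) ->
  tm t -> tm u -> d0 (fun c => R (t c) (u c)).
Proof.
  intros H [a Ht] [b Hu].
  destruct (is_tm_l b Ht) as [t' Ht'], (is_tm_r a Hu) as [u' Hu'].
  exists (merge a b), (Op t' u'). intros c. rewrite H, Ht', Hu'. reflexivity.
Qed.

Lemma d0_eq n (t u : ctx n -> num M) :
  tm t -> tm u -> d0 (fun c => t c = u c).
Proof. apply (d0_atom (Op := Eq)). reflexivity. Qed.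

Lemma d0_lt n (t u : ctx n -> num M) :
  tm t -> tm u -> d0 (fun c => t c < u c).
Proof. apply (d0_atom (Op := Lt)). reflexivity. Qed.

Lemma d0_mem n (t : ctx n -> num M) X : tm t -> d0 (fun c => t c ∈ X).
Proof.
  intros [a [u Hu]]. exists (Params (pnum a) (fun _ => X)), (In u 0).
  intros c. simpl. rewrite Hu. reflexivity.
Qed.

Lemma d0_not n (P : ctx n -> Prop) : d0 P -> d0 (fun c => ~ P c).
Proof.
  intros [a [f Hf]]. exists a, (Not f). intros c. simpl. rewrite Hf.
  reflexivity.
Qed.

Lemma d0_conn (op : Prop -> Prop -> Prop)
    (Op : bounded_formula -> bounded_formula -> bounded_formula)
    n (P Q : ctx n -> Prop) :
  (forall A A' B B' : Prop, (A <-> A') -> (B <-> B') -> (op A B <-> op A' B')) ->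
  (forall (e : nat -> num M) E f g,
     sat e E (Op f g) <-> op (sat e E f) (sat e E g)) ->
  d0 P -> d0 Q -> d0 (fun c => op (P c) (Q c)).
Proof.
  intros Hop H [a HP] [b HQ].
  destruct (is_d0_l b HP) as [f Hf], (is_d0_r a HQ) as [g Hg].
  exists (merge a b), (Op f g). intros c. rewrite H. apply Hop; auto.
Qed.

Lemma d0_and n (P Q : ctx n -> Prop) : d0 P -> d0 Q -> d0 (fun c => P c /\ Q c).
Proof. apply (d0_conn (Op := And)); [tauto | reflexivity]. Qed.

Lemma d0_or n (P Q : ctx n -> Prop) : d0 P -> d0 Q -> d0 (fun c => P c \/ Q c).
Proof. apply (d0_conn (Op := Or)); [tauto | reflexivity]. Qed.

Lemma d0_imp n (P Q : ctx n -> Prop) : d0 P -> d0 Q -> d0 (fun c => P c -> Q c).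
Proof.
  apply (d0_conn (op := fun A B => A -> B) (Op := Imp)); [tauto | reflexivity].
Qed.

Lemma d0_iff n (P Q : ctx n -> Prop) : d0 P -> d0 Q -> d0 (fun c => P c <-> Q c).
Proof.
  intros HP HQ. unfold iff. apply d0_and; apply d0_imp; assumption.
Qed.

Lemma d0_ball n (t : ctx n -> num M) (P : ctx n -> num M -> Prop) :
  tm t -> d0 (fun c : ctx (S n) => P (fst c) (snd c)) ->
  d0 (fun c => forall x, x < t c -> P c x).
Proof.
  intros [a Ht] [b HP].
  destruct (is_tm_l b Ht) as [t' Ht'], (is_d0_r a HP) as [f Hf].
  exists (merge a b), (BAll t' f). intros c. simpl. rewrite Ht'.
  split; intros H x Hx; specialize (H x Hx); apply (Hf (c, x)); auto.
Qed.

Lemma d0_bex n (t : ctx n -> num M) (P : ctx n -> num M -> Prop) :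
  tm t -> d0 (fun c : ctx (S n) => P (fst c) (snd c)) ->
  d0 (fun c => exists x, x < t c /\ P c x).
Proof.
  intros [a Ht] [b HP].
  destruct (is_tm_l b Ht) as [t' Ht'], (is_d0_r a HP) as [f Hf].
  exists (merge a b), (BEx t' f). intros c. simpl. rewrite Ht'.
  split; intros (x & Hx & H); exists x; split; auto; apply (Hf (c, x)); auto.
Qed.

(** * Maps between contexts given by terms *)

Fixpoint tms (n k : nat) : (ctx n -> ctx k) -> Prop :=
  match k with
  | O => fun _ => True
  | S k => fun g => tms (fun c => fst (g c)) /\ tm (fun c => snd (g c))
  end.

Lemma tms_const n k (d : ctx k) : tms (fun _ : ctx n => d).
Proof.
  induction k as [|k IH]; simpl; auto using tm_const.
Qed.

Lemma tms_weaken n k (g : ctx n -> ctx k) :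
  tms g -> tms (fun c : ctx (S n) => g (fst c)).
Proof.
  induction k as [|k IH]; simpl; auto.
  intros [H1 H2]. split; [apply (IH (fun c => fst (g c)) H1) |].
  apply (tm_weaken H2).
Qed.

Lemma tms_id n : tms (fun c : ctx n => c).
Proof.
  induction n as [|n IH]; simpl; auto.
  split; [apply (tms_weaken IH) | apply tm_var].
Qed.

(** One assignment has to serve all components, so assignments are merged along the context. The
    tail [p] is arbitrary, since only the first [k] variables are looked at. *)
Lemma tms_terms n k (g : ctx n -> ctx k) :
  tms g -> exists a s, forall c p i, (i < k)%nat ->
    eval (env c (pnum a)) (s i) = env (g c) p i.
Proof.
  induction k as [|k IH]; simpl.
  - intros _. destruct (sets_inhabited M) as [X].
    exists (Params (fun _ => zero) (fun _ => X)), Var. intros; lia.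
  - intros [Hg [b [u Hu]]]. destruct (IH _ Hg) as (a & s & Hs).
    exists (merge a b), (fun i => match i with
      | O => tsubst (reindex n (fun i => S (2 * i))%nat) u
      | S i => tsubst (reindex n (fun i => 2 * i)%nat) (s i) end).
    intros c p [|i] Hi; simpl.
    + rewrite Hu. apply eval_tsubst. intros i. apply eval_reindex.
      apply interleave_r.
    + rewrite <- Hs by lia. apply eval_tsubst. intros j. apply eval_reindex.
      apply interleave_l.
Qed.

Lemma d0_comp n k (Q : ctx k -> Prop) (g : ctx n -> ctx k) :
  d0 Q -> tms g -> d0 (fun c => Q (g c)).
Proof.
  intros [a HQ] Hg. destruct (tms_terms Hg) as (b & s & Hs).
  destruct (is_d0_l b HQ) as [f Hf].
  (* Context variables become the terms of [g], whose parameters sit at the odd indices; parameter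
     variables of [f] only move from offset [k] to offset [n]. *)
  exists (merge a b), (subst (fun i => if Nat.ltb i k
      then tsubst (reindex n (fun i => S (2 * i))%nat) (s i)
      else Var (n + (i - k))%nat) (fun X => X) f).
  intros c. rewrite Hf. symmetry. apply sat_subst; auto.
  intros i. destruct (Nat.ltb_spec i k) as [L|L].
  - rewrite <- Hs by lia. apply eval_tsubst. intros j. apply eval_reindex.
    apply interleave_r.
  - simpl. rewrite env_tail. replace i with (k + (i - k))%nat at 2 by lia.
    rewrite env_tail. reflexivity.
Qed.

Lemma d0_subst2 (P : num M -> num M -> Prop) n (t u : ctx n -> num M) :
  d0 (fun c : ctx 2 => P (snd (fst c)) (snd c)) -> tm t -> tm u ->
  d0 (fun c => P (t c) (u c)).
Proof.
  intros H Ht Hu. apply (d0_comp (k := 2) (g := fun c => (tt, t c, u c)) H).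
  simpl. auto.
Qed.

Lemma d0_subst (P : num M -> Prop) n (t : ctx n -> num M) :
  d0 (fun c : ctx 1 => P (snd c)) -> tm t -> d0 (fun c => P (t c)).
Proof.
  intros H Ht. apply (d0_comp (k := 1) (g := fun c => (tt, t c)) H). simpl. auto.
Qed.

Lemma s1_d0 n (P : ctx n -> Prop) : d0 P -> s1 P.
Proof.
  intros [a [f Hf]]. exists (fun c => P (fst c)). split.
  - exists a, (subst (fun i => Var (S i)) (fun X => X) f). intros [c x].
    simpl. rewrite Hf. symmetry. apply sat_subst; auto.
  - intros c. split; [intros H; exists zero; auto | intros [x H]; exact H].
Qed.

End Definability.

(* Weakening is inverted by evaluating the term at a context [(c, zero)]. *)
Ltac tm_var :=
  lazymatch goal with
  | |- @tm ?M (S ?n) (fun c => snd c) => exact (@tm_var M n)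
  | |- @tm ?M (S ?n) snd => exact (@tm_var M n)
  | |- @tm ?M (S ?n) ?f =>
      let g := eval cbn beta iota delta [fst snd] in
        (fun c : @ctx M n => f (c, zero)) in
      refine (@tm_weaken M n g _)
  end.

(** * Arithmetic *)

Ltac definable_tm :=
  first [assumption | apply tm_const | tm_var | apply tm_add | apply tm_mul].

(* Redefined whenever a new predicate is shown to be definable. *)
Ltac definable_derived := fail.

Ltac definable_hyp :=
  multimatch goal with
  | H : d0 (fun c : ctx 2 => ?P (snd (fst c)) (snd c)) |- d0 (fun _ => ?P _ _) =>
      apply (d0_subst2 H)
  | H : d0 (fun c : ctx 1 => ?P (snd c)) |- d0 (fun _ => ?P _) =>
      apply (d0_subst H)
  end.

Ltac definable_step :=
  lazymatch goal with
  | |- tm _ => definable_tm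
  | |- d0 (fun _ => _ = _) => apply d0_eq
  | |- d0 (fun _ => lt _ _) => apply d0_lt
  | |- d0 (fun _ => mem _ _) => apply d0_mem
  | |- d0 (fun _ => rel _ _ _) => apply d0_mem
  | |- d0 (fun _ => ~ _) => apply d0_not
  | |- d0 (fun _ => _ /\ _) => apply d0_and
  | |- d0 (fun _ => _ \/ _) => apply d0_or
  | |- d0 (fun _ => _ <-> _) => apply d0_iff
  | |- d0 (fun _ => forall x : num _, lt x _ -> _) => apply d0_ball
  | |- d0 (fun _ => exists x : num _, lt x _ /\ _) => apply d0_bex
  | |- d0 (fun _ => _ -> _) => apply d0_imp
  | |- d0 _ => first [definable_hyp | definable_derived]
  end; cbv beta.

Ltac definable := cbv beta; repeat definable_step.

Existing Class RCA0.

Section Arithmetic.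

Context {M : L2_structure} {hM : RCA0 M}.
Implicit Types x y z m n : num M.

Lemma s1_ind (A : num M -> Prop) :
  s1 (fun c : ctx 1 => A (snd c)) ->
  A zero -> (forall n, A n -> A (n + one)) -> forall n, A n.
Proof.
  intros (Q & (a & f & Hf) & HQ). apply (proj1 (proj2 hM)).
  exists f, (pnum a), (psets a). intros n. rewrite (HQ (tt, n)).
  split; intros [m Hm]; exists m; apply (Hf (tt, n, m)); auto.
Qed.

Lemma d0_ind (A : num M -> Prop) :
  d0 (fun c : ctx 1 => A (snd c)) ->
  A zero -> (forall n, A n -> A (n + one)) -> forall n, A n.
Proof. intros H. apply s1_ind. apply s1_d0. exact H. Qed.

Lemma comprehension (A : num M -> Prop) :
  s1 (fun c : ctx 1 => A (snd c)) -> s1 (fun c : ctx 1 => ~ A (snd c)) ->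
  exists X, forall n, n ∈ X <-> A n.
Proof.
  intros (Q & (a & f & Hf) & HQ) (Q' & (a' & f' & Hf') & HQ').
  apply (proj2 (proj2 hM)).
  - exists f, (pnum a), (psets a). intros n. rewrite (HQ (tt, n)).
    split; intros [m Hm]; exists m; apply (Hf (tt, n, m)); auto.
  - exists (Not f'), (pnum a'), (psets a'). intros n.
    specialize (HQ' (tt, n)). simpl in *. split.
    + intros HA m Hm. apply HQ'; [| exact HA]. exists m. apply Hf'. exact Hm.
    + intros H. apply NNPP. intros HA. apply HQ' in HA as [m Hm].
      apply (H m). apply (Hf' (tt, n, m)). exact Hm.
Qed.

Lemma d0_comprehension (A : num M -> Prop) :
  d0 (fun c : ctx 1 => A (snd c)) -> exists X, forall n, n ∈ X <-> A n.
Proof.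
  intros H. apply comprehension; apply s1_d0; [| apply d0_not]; exact H.
Qed.

Lemma succ_neq0 n : n + one <> zero.
Proof. destruct hM as [(H & _) _]. apply H. Qed.

Lemma succ_inj m n : m + one = n + one -> m = n.
Proof. destruct hM as [(_ & H & _) _]. apply H. Qed.

Lemma addn0 m : m + zero = m.
Proof. destruct hM as [(_ & _ & H & _) _]. apply H. Qed.

Lemma addnS m n : m + (n + one) = (m + n) + one.
Proof. destruct hM as [(_ & _ & _ & H & _) _]. apply H. Qed.

Lemma muln0 m : m * zero = zero.
Proof. destruct hM as [(_ & _ & _ & _ & H & _) _]. apply H. Qed.

Lemma mulnS m n : m * (n + one) = m * n + m.
Proof. destruct hM as [(_ & _ & _ & _ & _ & H & _) _]. apply H. Qed.

Lemma ltn0 m : ~ m < zero.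
Proof. destruct hM as [(_ & _ & _ & _ & _ & _ & H & _) _]. apply H. Qed.

Lemma ltS m n : m ≤ n <-> m < n \/ m = n.
Proof. destruct hM as [(_ & _ & _ & _ & _ & _ & _ & H) _]. apply H. Qed.

Lemma add0n n : zero + n = n.
Proof.
  revert n. apply d0_ind; [definable | apply addn0 |].
  intros n H. rewrite addnS, H. reflexivity.
Qed.

Lemma addSn m n : (m + one) + n = (m + n) + one.
Proof.
  revert n. apply d0_ind; [definable | rewrite !addn0; reflexivity |].
  intros n H. rewrite !addnS, H. reflexivity.
Qed.

Lemma addnC m n : m + n = n + m.
Proof.
  revert n. apply d0_ind; [definable | rewrite addn0, add0n; reflexivity |].
  intros n H. rewrite addnS, addSn, H. reflexivity.
Qed.

Lemma addnA m n p : m + (n + p) = (m + n) + p.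
Proof.
  revert p. apply d0_ind; [definable | rewrite !addn0; reflexivity |].
  intros p H. rewrite !addnS, H. reflexivity.
Qed.

Lemma mulnDl m n p : (m + n) * p = m * p + n * p.
Proof.
  revert p. apply d0_ind; [definable | rewrite !muln0, addn0; reflexivity |].
  intros p H. rewrite !mulnS, H, !addnA. f_equal.
  rewrite <- !addnA. f_equal. apply addnC.
Qed.

Lemma mul0n n : zero * n = zero.
Proof.
  revert n. apply d0_ind; [definable | apply muln0 |].
  intros n H. rewrite mulnS, H, addn0. reflexivity.
Qed.

Lemma mul1n n : one * n = n.
Proof.
  revert n. apply d0_ind; [definable | apply muln0 |].
  intros n H. rewrite mulnS, H. reflexivity.
Qed.

Lemma mulnC m n : m * n = n * m.
Proof.
  revert n. apply d0_ind; [definable | rewrite muln0, mul0n; reflexivity |].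
  intros n H. rewrite mulnS, mulnDl, mul1n, H. reflexivity.
Qed.

Lemma mulnA m n p : m * (n * p) = (m * n) * p.
Proof.
  revert p. apply d0_ind; [definable | rewrite !muln0; reflexivity |].
  intros p H. rewrite !mulnS, <- H, !(mulnC m), mulnDl. reflexivity.
Qed.

Lemma num_semiring : semi_ring_theory (@zero M) one add mul eq.
Proof.
  constructor; auto using add0n, addnC, addnA, mul1n, mul0n, mulnC, mulnA, mulnDl.
Qed.

Add Ring num_ring : num_semiring.

Lemma addnI m n p : m + p = n + p -> m = n.
Proof.
  revert p. apply (d0_ind (A := fun p => m + p = n + p -> m = n)).
  - definable.
  - rewrite !addn0. auto.
  - intros p H E. apply H, succ_inj. rewrite <- !addnS. exact E.
Qed.

Lemma ltE x y : x < y <-> exists z, y = x + z + one.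
Proof.
  split.
  (* Bounding the witness by [y + one] makes the statement bounded, so that [d0_ind] applies. *)
  - intros H. enough (K : ~ x < y \/ exists z, z < y + one /\ y = x + z + one).
    { destruct K as [K|(z & _ & K)]; [tauto | eauto]. }
    clear H. revert y. apply d0_ind; [definable | left; apply ltn0 |].
    intros y [H|(z & Hz & H)].
    + destruct (classic (x = y)) as [E|E].
      * right. exists zero. split; [| subst; ring].
        revert y H E. enough (K : forall y, zero < y + one) by auto.
        apply d0_ind; [definable | apply ltS; auto |].
        intros y Hy. apply ltS; auto.
      * left. rewrite ltS. tauto.
    + right. exists (z + one). split; [| rewrite H at 1; ring].
      enough (K : forall z y, z < y -> z + one < y + one) by auto.
      clear z y Hz H. intros z.
      apply (d0_ind (A := fun y => z < y -> z + one < y + one)).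
      * definable.
      * intros H; destruct (ltn0 H).
      * intros y IH H. apply ltS in H as [H|H]; apply ltS; [auto | right].
        congruence.
  - intros [z ->]. revert z. apply d0_ind; [definable | apply ltS; right; ring |].
    intros z H. apply ltS. left. replace (x + (z + one)) with (x + z + one) by ring.
    exact H.
Qed.

Lemma lt_trans x y z : x < y -> y < z -> x < z.
Proof.
  rewrite !ltE. intros [u ->] [v ->]. exists (u + v + one). ring.
Qed.

Lemma lt_irrefl x : ~ x < x.
Proof.
  rewrite ltE. intros [z H]. apply (@succ_neq0 z).
  apply (@addnI _ _ x). rewrite add0n. symmetry. rewrite H at 1. ring.
Qed.

Lemma lt_total x y : x < y \/ x = y \/ y < x.
Proof.
  revert y. apply d0_ind; [definable | |].
  - destruct (classic (x = zero)) as [->|H]; auto. right; right.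
    revert x H. apply (d0_ind (A := fun x => x <> zero -> zero < x)).
    + definable.
    + tauto.
    + intros n _ _. apply ltE. exists n. ring.
  - intros y [H|[->|H]].
    + left. apply ltS; auto.
    + left. apply ltS; auto.
    + apply ltE in H as [z ->]. destruct (classic (z = zero)) as [->|Hz].
      * right; left. ring.
      * right; right. apply ltE.
        assert (K : z = zero \/ exists w, w < z /\ z = w + one).
        { clear Hz. revert z. apply d0_ind; [definable | auto |].
          intros z _. right. exists z. split; [apply ltS |]; auto. }
        destruct K as [K|(w & _ & ->)]; [tauto |]. exists w. ring.
Qed.

End Arithmetic.

(** * Order, least elements and collection *)

Section Order.

Context {M : L2_structure} {hM : RCA0 M}.
Implicit Types x y z : num M.

Add Ring num_ring : (@num_semiring M hM).

Lemma leE x y : x ≤ y <-> exists z, y = x + z.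
Proof.
  rewrite ltE. split; intros [z H]; exists z.
  - apply (@addnI _ _ _ _ one). exact H.
  - rewrite H. ring.
Qed.

Lemma le_lt_trans x y z : x ≤ y -> y < z -> x < z.
Proof.
  rewrite leE, !ltE. intros [u ->] [v ->]. exists (u + v). ring.
Qed.

Lemma lt_le_trans x y z : x < y -> y ≤ z -> x < z.
Proof.
  rewrite leE, !ltE. intros [u ->] [v ->]. exists (u + v). ring.
Qed.

Lemma le_trans x y z : x ≤ y -> y ≤ z -> x ≤ z.
Proof.
  rewrite !leE. intros [u ->] [v ->]. exists (u + v). ring.
Qed.

Lemma le_refl x : x ≤ x.
Proof. apply ltS. auto. Qed.

Lemma lt_le x y : x < y -> x ≤ y.
Proof. intros H. apply ltS. auto. Qed.

Lemma le0n x : zero ≤ x.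
Proof. apply leE. exists x. ring. Qed.

Lemma not_lt x y : ~ x < y <-> y ≤ x.
Proof.
  rewrite ltS. destruct (lt_total x y) as [H|[->|H]].
  - split; [tauto |]. intros [K| ->] _; eapply lt_irrefl; eauto.
    eapply lt_trans; eauto.
  - pose proof (@lt_irrefl _ _ y). tauto.
  - split; [tauto |]. intros _ K. eapply lt_irrefl, lt_trans; eauto.
Qed.

Lemma le_antisym x y : x ≤ y -> y ≤ x -> x = y.
Proof.
  intros H K. apply not_lt in H. apply ltS in K as [K|K]; [tauto | auto].
Qed.

Lemma leS_lt x y : x + one ≤ y <-> x < y.
Proof.
  rewrite leE, ltE. split; intros [z ->]; exists z; ring.
Qed.

Lemma lt_leS x y : x + one ≤ y -> x < y.
Proof. apply leS_lt. Qed.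

Lemma le_addr x y : x ≤ x + y.
Proof. apply leE. exists y. ring. Qed.

Lemma le_addl x y : y ≤ x + y.
Proof. apply leE. exists x. ring. Qed.

Lemma zero_or_succ (n : num M) : n = zero \/ exists m, n = m + one.
Proof.
  destruct (classic (n = zero)) as [H|H]; auto. right.
  assert (K : ~ n < zero + one).
  { rewrite ltS. intros [K|K]; [exact (ltn0 K) | auto]. }
  apply not_lt, leE in K as [z ->]. exists z. ring.
Qed.

Lemma le_square (n : num M) : n ≤ n * n.
Proof.
  apply leE. destruct (zero_or_succ n) as [->|[m ->]].
  - exists zero. ring.
  - exists (m * (m + one)). ring.
Qed.

Lemma least (A : num M -> Prop) :
  d0 (fun c : ctx 1 => A (snd c)) -> (exists n, A n) ->
  exists n, A n /\ forall k, k < n -> ~ A k.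
Proof.
  intros HA [n Hn]. apply NNPP. intros H.
  enough (K : forall n k, k < n -> ~ A k).
  { apply (K (n + one) n); auto. apply le_refl. }
  apply (d0_ind (A := fun n => forall k, k < n -> ~ A k)).
  - definable.
  - intros k Hk. destruct (ltn0 Hk).
  - intros m IH k Hk Ak. apply ltS in Hk as [Hk| ->].
    + exact (IH k Hk Ak).
    + apply H. eauto.
Qed.

Lemma s1_binary (A : num M -> Prop) :
  s1 (fun c : ctx 1 => A (snd c)) ->
  exists P : num M -> num M -> Prop,
    d0 (fun c : ctx 2 => P (snd (fst c)) (snd c)) /\
    forall n, A n <-> exists x, P n x.
Proof.
  intros (Q & HQ & E). exists (fun n x => Q (tt, n, x)). split.
  - apply (d0_comp (k := 2) (g := fun c : ctx 2 => (tt, snd (fst c), snd c)) HQ).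
    cbn [tms fst snd]. repeat split; repeat tm_var.
  - intros n. apply (E (tt, n)).
Qed.

Lemma s1_ext n (Q P : @ctx M n -> Prop) :
  (forall c, P c <-> Q c) -> s1 Q -> s1 P.
Proof.
  intros H (R & HR & E). exists R. split; auto. intros c. rewrite H. apply E.
Qed.

(** Two unbounded quantifiers contract into one over a common bound for both witnesses. *)
Lemma s1_ex n (P : @ctx M n -> num M -> Prop) :
  s1 (fun c : ctx (S n) => P (fst c) (snd c)) -> s1 (fun c => exists x, P c x).
Proof.
  intros (Q & HQ & E).
  exists (fun c : ctx (S n) => exists x, x < snd c /\
            exists y, y < snd c /\ Q (fst c, x, y)).
  split.
  - definable.
    apply (d0_comp (k := S (S n)) (g := fun c : ctx (S (S (S n))) =>
      (fst (fst (fst c)), snd (fst c), snd c)) HQ).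
    cbn [tms fst snd]. repeat split; try solve [repeat tm_var].
    apply (tms_weaken (g := fun c : ctx (S (S n)) => fst (fst c))).
    apply (tms_weaken (g := fun c : ctx (S n) => fst c)).
    apply (tms_weaken (g := fun c : ctx n => c)).
    apply tms_id.
  - intros c. simpl. split.
    + intros [x Hx]. apply (E (c, x)) in Hx as [y Hy].
      exists (x + y + one), x. split; [apply le_addr |].
      exists y. split; [apply le_addl | exact Hy].
    + intros (z & x & _ & y & _ & H). exists x. apply (E (c, x)). eauto.
Qed.

Lemma s1_and n (P P' : @ctx M n -> Prop) :
  s1 P -> s1 P' -> s1 (fun c => P c /\ P' c).
Proof.
  intros (Q & HQ & E) (Q' & HQ' & E').
  apply s1_ext with (fun c => exists x, exists y, Q (c, x) /\ Q' (c, y)).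
  - intros c. rewrite E, E'. split.
    + intros [[x Hx] [y Hy]]. exists x, y. auto.
    + intros (x & y & Hx & Hy). eauto.
  - do 2 apply s1_ex. apply s1_d0, d0_and.
    + apply (d0_comp (k := S n)
        (g := fun c : ctx (S (S n)) => (fst (fst c), snd (fst c))) HQ).
      simpl. split; [| repeat tm_var].
      apply (tms_weaken (g := fun c : ctx (S n) => fst c)).
      apply (tms_weaken (g := fun c : ctx n => c)), tms_id.
    + apply (d0_comp (k := S n) (g := fun c : ctx (S (S n)) => (fst (fst c), snd c)) HQ').
      simpl. split; [| tm_var].
      apply (tms_weaken (g := fun c : ctx (S n) => fst c)).
      apply (tms_weaken (g := fun c : ctx n => c)), tms_id.
Qed.

Lemma s1_or n (P P' : @ctx M n -> Prop) :
  s1 P -> s1 P' -> s1 (fun c => P c \/ P' c).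
Proof.
  intros (Q & HQ & E) (Q' & HQ' & E').
  exists (fun c => Q c \/ Q' c). split; [apply d0_or; auto |].
  intros c. rewrite E, E'. split.
  - intros [[x Hx]|[x Hx]]; eauto.
  - intros [x [Hx|Hx]]; eauto.
Qed.

(** Induction on [k] collects a bound for all [x < k]; at the next step it is enlarged by the
    witness for [k]. *)
Lemma collection n (Q : @ctx M (S (S n)) -> Prop) (c : ctx n) t :
  d0 Q -> (forall x, x < t -> exists y, Q (c, x, y)) ->
  exists b, forall x, x < t -> exists y, y < b /\ Q (c, x, y).
Proof.
  intros HQ H.
  (* The premise [k ≤ t] stands inside the quantifier over [b], which keeps the statement [s1];
     beyond [t] any [b] will do. *)
  enough (K : forall k, exists b, k ≤ t -> forall x, x < k ->
      exists y, y < b /\ Q (c, x, y)).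
  { destruct (K t) as [b Hb]. exists b. apply Hb, le_refl. }
  apply (s1_ind (A := fun k => exists b, k ≤ t -> forall x, x < k ->
      exists y, y < b /\ Q (c, x, y))).
  - apply s1_ex, s1_d0. definable.
    apply (d0_comp (k := S (S n)) (g := fun d : ctx 4 => (c, snd (fst d), snd d)) HQ).
    cbn [tms fst snd]. repeat split; try solve [repeat tm_var]. apply tms_const.
  - exists zero. intros _ x Hx. destruct (ltn0 Hx).
  - intros k [b Hb]. destruct (classic (k < t)) as [Hk|Hk].
    + destruct (H k Hk) as [y Hy]. exists (b + y + one). intros _ x Hx.
      apply ltS in Hx as [Hx| ->].
      * destruct (Hb (lt_le Hk) x Hx) as (z & Hz & HQz). exists z.
        split; auto. eapply lt_le_trans; [exact Hz |].
        apply leE. exists (y + one). ring.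
      * exists y. split; auto. apply le_addl.
    + exists zero. intros K. destruct Hk. apply leS_lt. exact K.
Qed.

(** By collection, one number bounds the witnesses for all [x < t c], and it can be quantified in
    front. *)
Lemma s1_ball n (t : @ctx M n -> num M) (P : ctx n -> num M -> Prop) :
  tm t -> s1 (fun c : ctx (S n) => P (fst c) (snd c)) ->
  s1 (fun c => forall x, x < t c -> P c x).
Proof.
  intros Ht (Q & HQ & E).
  exists (fun c : ctx (S n) => forall x, x < t (fst c) ->
            exists y, y < snd c /\ Q (fst c, x, y)).
  split.
  - definable.
    apply (d0_comp (k := S (S n)) (g := fun c : ctx (S (S (S n))) =>
      (fst (fst (fst c)), snd (fst c), snd c)) HQ).
    cbn [tms fst snd]. repeat split; try solve [repeat tm_var].
    apply (tms_weaken (g := fun c : ctx (S (S n)) => fst (fst c))).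
    apply (tms_weaken (g := fun c : ctx (S n) => fst c)).
    apply (tms_weaken (g := fun c : ctx n => c)).
    apply tms_id.
  - intros c. simpl. split.
    + intros H. apply collection; auto. intros x Hx.
      apply (E (c, x)). simpl. auto.
    + intros [b Hb] x Hx. destruct (Hb x Hx) as (y & _ & Hy).
      apply (E (c, x)). eauto.
Qed.

End Order.

Ltac sigma_step :=
  first
    [ solve [apply s1_d0; definable]
    | lazymatch goal with
      | |- s1 (fun _ => exists x, _) => apply s1_ex
      | |- s1 (fun _ => _ /\ _) => apply s1_and
      | |- s1 (fun _ => _ \/ _) => apply s1_or
      | |- s1 (fun _ => forall x : num _, lt x _ -> _) => apply s1_ball
      | |- tm _ => definable_tm
      end; cbv beta ].

Ltac sigma := cbv beta; repeat sigma_step.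

Definition separation (M : L2_structure) : Prop :=
  forall A B : num M -> Prop,
    s1 (fun c : ctx 1 => A (snd c)) -> s1 (fun c : ctx 1 => B (snd c)) ->
    (forall n, ~ (A n /\ B n)) ->
    exists X, forall n, (A n -> n ∈ X) /\ (B n -> ~ n ∈ X).

(** * Pairs and coding of bounded sets *)

Section Coding.

Context {M : L2_structure} {hM : RCA0 M}.
Implicit Types a b d e i j k l m n q r s t u v w x y z N : num M.

Add Ring num_ring : (@num_semiring M hM).

(** The searches for a witness of [A n] and of [B n] run in parallel, and [n] enters [X] if the
    first one succeeds no later than the second. As the classes cover everything, some search
    succeeds, so the complement of [X] is [s1] too. *)
Lemma reduction (A B : num M -> Prop) :
  s1 (fun c : ctx 1 => A (snd c)) -> s1 (fun c : ctx 1 => B (snd c)) ->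
  (forall n, A n \/ B n) ->
  exists X, forall n, (n ∈ X -> A n) /\ (~ n ∈ X -> B n).
Proof.
  intros HA HB HAB.
  destruct (s1_binary HA) as (P & HP & EP), (s1_binary HB) as (Q & HQ & EQ).
  destruct (comprehension (A := fun n => exists w, P n w /\
    forall v, v < w -> ~ Q n v)) as [X HX].
  - sigma.
  - apply s1_ext with (fun c => exists w, Q (snd c) w /\
      forall v, v ≤ w -> ~ P (snd c) v).
    + intros [c n]. simpl. clear c. split.
      * intros H.
        destruct (least (A := fun w => P n w \/ Q n w)) as (w & Hw & Hl).
        { definable. }
        { destruct (HAB n) as [K|K]; [apply EP in K | apply EQ in K];
            destruct K as [w K]; eauto. }
        assert (nP : ~ P n w).
        { intros K. apply H. exists w. split; auto. intros v Hv Kv.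
          apply (Hl v Hv). auto. }
        exists w. split; [tauto |]. intros v Hv Kv.
        apply ltS in Hv as [Hv| ->]; [apply (Hl v Hv) |]; auto.
      * intros (w & Qw & Hw) (v & Pv & Hv).
        destruct (lt_total v w) as [L|[L|L]].
        -- apply (Hw v); auto. apply lt_le; auto.
        -- subst. apply (Hw w); auto. apply le_refl.
        -- apply (Hv w); auto.
    + sigma.
  - exists X. intros n. rewrite HX. split.
    + intros (w & Hw & _). apply EP. eauto.
    + intros H. apply EQ. destruct (classic (exists w, Q n w)) as [K|K]; auto.
      destruct H. destruct (HAB n) as [K1|K1]; [| apply EQ in K1; tauto].
      apply EP in K1 as [w Hw]. exists w. split; auto. intros v _ Qv.
      apply K; eauto.
Qed.

(** * The pairing function *)

(** [pair i j] is at least the square of [i + j] and less than the square of [i + j + one], so pairs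
    are ordered by their sums first. *)
Lemma pair_lt i j i' j' : i + j < i' + j' -> pair i j < pair i' j'.
Proof.
  unfold pair. rewrite (ltE (i + j)). intros [z ->]. apply ltE.
  exists (j + z * z + z + z + (i + j) * z + (i + j) * z + (i + j) + i').
  ring.
Qed.

Lemma pair_inj i j i' j' : pair i j = pair i' j' -> i = i' /\ j = j'.
Proof.
  intros E. destruct (lt_total (i + j) (i' + j')) as [H|[H|H]].
  - apply pair_lt in H. rewrite E in H. destruct (lt_irrefl H).
  - unfold pair in E. rewrite H in E.
    assert (K : i = i').
    { apply addnI with ((i' + j') * (i' + j')).
      rewrite !(addnC _ ((i' + j') * (i' + j'))). exact E. }
    split; auto. subst i'. apply addnI with i. rewrite !(addnC _ i). exact H.
  - apply pair_lt in H. rewrite E in H. destruct (lt_irrefl H).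
Qed.

Lemma le_pair i j i' j' : i ≤ i' -> j ≤ j' -> pair i j ≤ pair i' j'.
Proof.
  rewrite !leE. intros [u ->] [v ->]. unfold pair.
  exists ((i + j) * (u + v) + (i + j) * (u + v) + (u + v) * (u + v) + u). ring.
Qed.

Lemma le_pair_l i j : i ≤ pair i j.
Proof. apply le_addl. Qed.

Lemma le_pair_r i j : j ≤ pair i j.
Proof.
  eapply le_trans; [apply (le_square j) |]. unfold pair. apply leE.
  exists (i * i + i * j + i * j + i). ring.
Qed.

(** * Divisibility, congruences and inverses *)

Definition dvd d n : Prop := exists q, n = q * d.

(** A bound on the quotient makes divisibility [d0]. For [d = zero] the quotient has to be replaced
    by zero. *)
Lemma dvdE d n : dvd d n <-> exists q, q ≤ n /\ n = q * d.
Proof.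
  split; [| intros (q & _ & H); exists q; exact H].
  intros [q ->]. destruct (zero_or_succ d) as [->|[e ->]].
  - exists zero. split; [| ring]. replace (q * zero) with (@zero M) by ring.
    apply le_refl.
  - exists q. split; auto. apply leE. exists (q * e). ring.
Qed.

Lemma d0_dvd (k : nat) (s t : @ctx M k -> num M) :
  tm s -> tm t -> d0 (fun c => dvd (s c) (t c)).
Proof.
  intros Hs Ht. eapply d0_ext; [intros c; apply dvdE |]. definable.
Qed.

Ltac definable_derived ::= apply d0_dvd.

Lemma dvd_mulr d n x : dvd d n -> dvd d (n * x).
Proof. intros [q ->]. exists (q * x). ring. Qed.

Lemma dvd_le d n : n <> zero -> dvd d n -> d ≤ n.
Proof.
  intros Hn [q E]. destruct (zero_or_succ q) as [->|[p ->]].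
  - destruct Hn. rewrite E. ring.
  - apply leE. exists (p * d). rewrite E. ring.
Qed.

(** Without subtraction there are two cases: either [a ≤ q] and the difference is the new quotient,
    or [x] is forced to be zero. *)
Lemma dvd_cancel d x a : dvd d (x + a * d) -> dvd d x.
Proof.
  intros [q E]. destruct (classic (q < a)) as [H|H].
  - apply ltE in H as [z ->]. exists zero.
    assert (K : x + (z * d + d) = zero).
    { apply addnI with (q * d). rewrite <- (add0n (q * d)) in E.
      transitivity (zero + q * d); [rewrite <- E |]; ring. }
    destruct (zero_or_succ x) as [->|[w ->]]; [ring |].
    destruct (@succ_neq0 M _ (w + (z * d + d))). rewrite <- K. ring.
  - apply not_lt, leE in H as [w ->]. exists w. apply addnI with (a * d).
    rewrite E. ring.
Qed.

(** Multiples are added on both sides because there are no negative numbers. *)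
Definition cong d x y : Prop := exists a b, x + a * d = y + b * d.

#[local] Instance cong_equiv d : Equivalence (cong d).
Proof.
  split.
  - intros x. exists zero, zero. reflexivity.
  - intros x y (a & b & E). exists b, a. auto.
  - intros x y z (a & b & E) (a' & b' & E'). exists (a + a'), (b + b').
    replace (x + (a + a') * d) with (x + a * d + a' * d) by ring.
    rewrite E. replace (y + b * d + a' * d) with (y + a' * d + b * d) by ring.
    rewrite E'. ring.
Qed.

#[local] Instance cong_add d : Proper (cong d ==> cong d ==> cong d) add.
Proof.
  intros x y (a & b & E) x' y' (a' & b' & E'). exists (a + a'), (b + b').
  transitivity ((x + a * d) + (x' + a' * d)); [ring |].
  rewrite E, E'. ring.
Qed.

#[local] Instance cong_mul d : Proper (cong d ==> cong d ==> cong d) mul.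
Proof.
  intros x y (a & b & E) x' y' (a' & b' & E').
  exists (a * x' + x * a' + a * a' * d), (b * y' + y * b' + b * b' * d).
  transitivity ((x + a * d) * (x' + a' * d)); [ring |].
  rewrite E, E'. ring.
Qed.

Lemma cong_mod d x : cong d (x * d) zero.
Proof. exists zero, x. ring. Qed.

Lemma cong_addI d x y w : cong d (x + w) (y + w) -> cong d x y.
Proof.
  intros (a & b & E). exists a, b. apply addnI with w.
  transitivity (x + w + a * d); [ring |]. rewrite E. ring.
Qed.

Lemma cong_dvd d x y : cong d x y -> dvd d x -> dvd d y.
Proof.
  intros (a & b & E) [q ->]. apply dvd_cancel with b. rewrite <- E.
  exists (q + a). ring.
Qed.

(** Invertibility stands in for coprimality: closure under products, passage to divisors and Gauss's
    lemma are then short computations with congruences. *)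
Definition inv d n : Prop := exists u, cong d (u * n) one.

Lemma inv_mul d x y : inv d x -> inv d y -> inv d (x * y).
Proof.
  intros [u Hu] [v Hv]. exists (u * v).
  replace (u * v * (x * y)) with (u * x * (v * y)) by ring.
  rewrite Hu, Hv. rewrite mul1n. reflexivity.
Qed.

Lemma inv_one d : inv d one.
Proof. exists one. rewrite mul1n. reflexivity. Qed.

Lemma inv_divisor d x y : inv d (x * y) -> inv d y.
Proof.
  intros [u Hu]. exists (u * x). rewrite <- mulnA. exact Hu.
Qed.

Lemma inv_gauss d n x : inv d n -> dvd d (n * x) -> dvd d x.
Proof.
  intros [u Hu] H. apply cong_dvd with (u * n * x).
  - rewrite Hu, mul1n. reflexivity.
  - replace (u * n * x) with (n * x * u) by ring. apply dvd_mulr. exact H.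
Qed.

(** By Gauss's lemma the modulus divides one. *)
Lemma inv_not_dvd d n : inv (d + one) n -> dvd (d + one) n -> d = zero.
Proof.
  intros H K. assert (D : dvd (d + one) one).
  { apply (inv_gauss H). apply dvd_mulr. exact K. }
  apply dvd_le in D; [| intros E; apply (@succ_neq0 M _ zero); rewrite add0n; auto].
  apply lt_leS in D. assert (K' : d ≤ zero) by (rewrite add0n; exact D).
  apply ltS in K' as [K'|K']; [destruct (ltn0 K') | exact K'].
Qed.

(** The moduli of Gödel's beta function; [fin_mem] tests divisibility by them. *)
Definition modulus m i := m * (i + one) + one.

Lemma cong_modulus m j : cong (modulus m j) (m * (j + one) + one) zero.
Proof.
  rewrite <- (mul1n (m * (j + one) + one)). apply cong_mod.
Qed.

(** Modulo [m * (j + one) + one] the number [m * (j + one)] is minus one. Its square is one, so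
    [m * (j + one) * (j + one)] inverts [m]. *)
Lemma inv_modulus m j : inv (modulus m j) m.
Proof.
  exists (m * (j + one) * (j + one)).
  replace (m * (j + one) * (j + one) * m)
    with (m * (j + one) * (m * (j + one))) by ring.
  apply cong_addI with (m * (j + one) + (m * (j + one) + one)).
  transitivity ((m * (j + one) + one) * (m * (j + one) + one)).
  - replace ((m * (j + one) + one) * (m * (j + one) + one))
      with (m * (j + one) * (m * (j + one)) + (m * (j + one) + (m * (j + one) + one)))
      by ring. reflexivity.
  - rewrite cong_modulus, !addn0.
    transitivity (m * (j + one) + one); [rewrite cong_modulus, muln0; reflexivity |].
    rewrite addnC. reflexivity.
Qed.

(* The moduli differ by [m] times a divisor of [m], and [m] is invertible
   modulo each of them. *)
Lemma inv_moduli k m i j :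
  (forall i, i < k -> dvd (i + one) m) -> i < k -> j < k -> i <> j ->
  inv (modulus m j) (modulus m i).
Proof.
  intros Hm Hi Hj Hij.
  assert (K : forall e, e < k -> inv (modulus m j) (m * (e + one))).
  { intros e He. destruct (Hm e He) as [g Hg].
    apply inv_mul; [apply inv_modulus |].
    apply inv_divisor with g. rewrite <- Hg. apply inv_modulus. }
  destruct (lt_total i j) as [L|[L|L]]; [| tauto |].
  - apply ltE in L as [e L]. destruct (K e) as [u Hu].
    { apply (le_lt_trans (y := j)); auto. rewrite L.
      apply leE. exists (i + one). ring. }
    (* As [i < j], the number [modulus m i] is congruent to minus [m * (e + one)], so its inverse is
       minus [u]; the factor [m * (j + one)] stands for minus one. *)
    exists (m * (j + one) * u).
    apply cong_addI with (m * (j + one)).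
    rewrite (addnC one), cong_modulus.
    transitivity (m * (j + one) * u * modulus m i
      + m * (j + one) * (u * (m * (e + one)))).
    + rewrite Hu. rewrite (mulnC (m * (j + one)) one), mul1n. reflexivity.
    + replace (m * (j + one) * u * modulus m i
        + m * (j + one) * (u * (m * (e + one))))
        with (m * (j + one) * u * (m * (j + one) + one))
        by (unfold modulus; rewrite L; ring).
      rewrite cong_modulus, muln0. reflexivity.
  - apply ltE in L as [e L]. destruct (K e) as [u Hu].
    { apply (le_lt_trans (y := i)); auto. rewrite L.
      apply leE. exists (j + one). ring. }
    exists u. rewrite <- Hu. unfold modulus at 2. rewrite L.
    replace (u * (m * (j + e + one + one) + one))
      with (u * (m * (j + one) + one) + u * (m * (e + one))) by ring.
    rewrite cong_modulus, muln0, add0n. reflexivity.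
Qed.

(* [m] and [N] allow every subset of [{i | i < k}] to be represented, by a
   divisor of [N]. *)
Definition base k m N : Prop :=
  m <> zero /\ (forall i, i < k -> dvd (i + one) m) /\
  N <> zero /\ (forall i, i < k -> dvd (modulus m i) N).

Lemma mul_neq0 x y : x <> zero -> y <> zero -> x * y <> zero.
Proof.
  intros Hx Hy.
  destruct (zero_or_succ x) as [|[a ->]], (zero_or_succ y) as [|[b ->]]; try tauto.
  replace ((a + one) * (b + one)) with (a * b + a + b + one) by ring.
  apply succ_neq0.
Qed.

(** Induction on [k] multiplies up the [f i], in place of a product defined by recursion. The second
    hypothesis says that [f] is given by a term. *)
Lemma common_multiple (f : num M -> num M) k :
  (forall i, f i <> zero) ->
  (forall (n : nat) (t : @ctx M n -> num M), tm t -> tm (fun c => f (t c))) ->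
  exists m, m <> zero /\ forall i, i < k -> dvd (f i) m.
Proof.
  intros Hf df. revert k.
  apply (s1_ind (A := fun k => exists m, m <> zero /\
    forall i, i < k -> dvd (f i) m)).
  - apply s1_ex, s1_d0. definable. apply df. definable.
  - exists one. split.
    + intros E. apply (@succ_neq0 M _ zero). rewrite add0n. exact E.
    + intros i Hi. destruct (ltn0 Hi).
  - intros k (m & Hm & H). exists (m * f k). split; [apply mul_neq0; auto |].
    intros i Hi. apply ltS in Hi as [Hi| ->].
    + apply dvd_mulr; auto.
    + exists m. reflexivity.
Qed.

Lemma base_exists k : exists m N, base k m N.
Proof.
  destruct (common_multiple (f := fun i => i + one) k) as (m & Hm & H).
  { intros. apply succ_neq0. }
  { intros. definable. }
  destruct (common_multiple (f := fun i => modulus m i) k) as (N & HN & H').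
  { intros. apply succ_neq0. }
  { intros. definable. }
  exists m, N. repeat split; auto.
Qed.

Lemma divisor_exists k m N (A : num M -> Prop) :
  base k m N -> d0 (fun c : ctx 1 => A (snd c)) ->
  exists n, n ≤ N /\ forall i, i < k -> (dvd (modulus m i) n <-> A i).
Proof.
  intros (Hm & Hmk & HN & HNk) HA.
  assert (K : forall l, exists n, l ≤ k -> dvd n N /\
    (forall i, i < l -> A i -> dvd (modulus m i) n) /\
    (forall j, j < k -> (l ≤ j \/ ~ A j) -> inv (modulus m j) n)).
  { apply (s1_ind (A := fun l => exists n, l ≤ k -> dvd n N /\
    (forall i, i < l -> A i -> dvd (modulus m i) n) /\
    (forall j, j < k -> (l ≤ j \/ ~ A j) -> inv (modulus m j) n))).
    - apply s1_ex.
      (* Rewritten so that the quantifiers of [inv] occur only positively, under connectives and a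
         bounded quantifier. *)
      apply s1_ext with (fun c => ~ snd (fst c) ≤ k \/ (dvd (snd c) N /\
        (forall i, i < snd (fst c) -> A i -> dvd (modulus m i) (snd c)) /\
        (forall j, j < k -> (~ (snd (fst c) ≤ j \/ ~ A j)) \/
          exists u x y, u * snd c + x * modulus m j = one + y * modulus m j))).
      + intros c. split.
        * intros H. destruct (classic (snd (fst c) ≤ k)) as [L|L]; auto. right.
          destruct (H L) as (H1 & H2 & H3). repeat split; auto.
          intros j Hj. specialize (H3 j Hj). unfold inv, cong in H3. tauto.
        * intros [H|(H1 & H2 & H3)] L; [tauto |]. repeat split; auto.
          intros j Hj Hj'. destruct (H3 j Hj) as [H|H]; [tauto | exact H].
      + sigma.
    - exists one. intros _. repeat split.
      + exists N. ring.
      + intros i Hi. destruct (ltn0 Hi).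
      + intros. apply inv_one.
    - intros l (n & IH). destruct (classic (l < k)) as [Hl|Hl].
      + destruct (IH (lt_le Hl)) as (HnN & Hn & Hinv).
        destruct (classic (A l)) as [Al|Al].
        * exists (n * modulus m l). intros _. repeat split.
          -- destruct HnN as [x Hx]. rewrite Hx.
             (* The new factor divides [N], which is [x * n], and [n] is invertible modulo it; hence
                it divides the cofactor [x]. *)
             destruct (inv_gauss (d := modulus m l) (n := n) (x := x)) as [y Hy].
             { apply Hinv; auto. left. apply le_refl. }
             { rewrite mulnC, <- Hx. auto. }
             exists y. rewrite Hy. ring.
          -- intros i Hi Ai. apply ltS in Hi as [Hi| ->].
             ++ apply dvd_mulr; auto.
             ++ exists n. reflexivity.
          -- intros j Hj Hlj. apply inv_mul.
             ++ apply Hinv; auto. destruct Hlj as [L|L]; auto. left.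
                apply lt_le, lt_leS, L.
             ++ apply (inv_moduli Hmk); auto. intros ->.
                destruct Hlj as [L|L]; [| tauto]. apply lt_leS in L.
                exact (lt_irrefl L).
        * exists n. intros _. repeat split; auto.
          -- intros i Hi Ai. apply ltS in Hi as [Hi| ->]; [auto | tauto].
          -- intros j Hj Hlj. apply Hinv; auto. destruct Hlj as [L|L]; auto.
             left. apply lt_le, lt_leS, L.
      + exists one. intros L. destruct Hl. apply lt_leS, L. }
  destruct (K k) as [n Hn]. destruct (Hn (le_refl k)) as (HnN & H1 & H2).
  exists n. split; [apply dvd_le; auto |].
  intros i Hi. split; [| auto].
  intros D. apply NNPP. intros nA.
  assert (E : m * (i + one) = zero).
  { apply inv_not_dvd with n; [apply H2; auto | exact D]. }
  revert E. apply mul_neq0; [auto | apply succ_neq0].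
Qed.

(** * Binary sequences *)

Lemma fin_memE i c : fin_mem i c <->
  exists k, k ≤ c /\ exists m, m ≤ c /\ exists n, n ≤ c /\
    c = pair (pair k m) n /\ i < k /\ dvd (modulus m i) n.
Proof.
  split.
  - intros (k & m & n & E & H). exists k. split.
    { rewrite E. eapply le_trans; [| apply le_pair_l]. apply le_pair_l. }
    exists m. split.
    { rewrite E. eapply le_trans; [| apply le_pair_l]. apply le_pair_r. }
    exists n. split; [rewrite E; apply le_pair_r |]. auto.
  - intros (k & _ & m & _ & n & _ & H). exists k, m, n. exact H.
Qed.

Lemma d0_fin_mem (k : nat) (s t : @ctx M k -> num M) :
  tm s -> tm t -> d0 (fun c => fin_mem (s c) (t c)).
Proof.
  intros Hs Ht. eapply d0_ext; [intros c; apply fin_memE |]. definable.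
Qed.

Lemma fin_mem_lt i c : fin_mem i c -> i < c.
Proof.
  intros (k & m & n & E & Hi & _). eapply lt_le_trans; [exact Hi |]. rewrite E.
  eapply le_trans; [| apply le_pair_l]. apply le_pair_l.
Qed.

Ltac definable_derived ::= first [apply d0_dvd | apply d0_fin_mem].

Lemma tripleE c : triple c <->
  exists k, k ≤ c /\ exists m, m ≤ c /\ exists n, n ≤ c /\ c = pair (pair k m) n.
Proof.
  split.
  - intros (k & m & n & E). exists k. split.
    { rewrite E. eapply le_trans; [| apply le_pair_l]. apply le_pair_l. }
    exists m. split.
    { rewrite E. eapply le_trans; [| apply le_pair_l]. apply le_pair_r. }
    exists n. split; [rewrite E; apply le_pair_r | exact E].
  - intros (k & _ & m & _ & n & _ & E). exists k, m, n. exact E.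
Qed.

Lemma d0_triple (k : nat) (t : @ctx M k -> num M) :
  tm t -> d0 (fun c => triple (t c)).
Proof.
  intros Ht. eapply d0_ext; [intros c; apply tripleE |]. definable.
Qed.

(** Members of a code lie below it, which bounds the quantifier hidden in [fin_code]. *)
Lemma same_fin_memE c d : d < c ->
  (forall i, fin_mem i d <-> fin_mem i c) <->
  (forall i, i < c -> (fin_mem i d <-> fin_mem i c)).
Proof.
  intros L. split; auto. intros H i. split; intros K.
  - apply H; auto. eapply lt_trans; [apply fin_mem_lt, K | exact L].
  - apply H; auto. apply fin_mem_lt, K.
Qed.

Lemma d0_fin_code (k : nat) (t : @ctx M k -> num M) :
  tm t -> d0 (fun c => fin_code (t c)).
Proof.
  intros Ht. apply d0_ext with (fun c => triple (t c) /\ forall d, d < t c ->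
    triple d -> ~ forall i, i < t c -> (fin_mem i d <-> fin_mem i (t c))).
  - intros c. unfold fin_code.
    split; intros [H K]; split; auto; intros d Hd Td Hs; apply (K d Hd Td);
      apply (same_fin_memE Hd); auto.
  - definable; apply d0_triple; definable.
Qed.

Lemma fin_code_inj c d : fin_code c -> fin_code d ->
  (forall i, fin_mem i c <-> fin_mem i d) -> c = d.
Proof.
  intros [Tc Hc] [Td Hd] H. destruct (lt_total c d) as [L|[L|L]]; auto.
  - destruct (Hd c L Tc H).
  - destruct (Hc d L Td). intros i. symmetry. apply H.
Qed.

(* All subsets of [{i | i < k}] have a code below [b]. *)
Definition bound k b : Prop :=
  exists m N, base k m N /\ b = pair (pair k m) N.

Lemma bound_exists k : exists b, bound k b.
Proof.
  destruct (base_exists k) as (m & N & H). exists (pair (pair k m) N), m, N. auto.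
Qed.

Lemma d0_bound (k : nat) (s t : @ctx M k -> num M) :
  tm s -> tm t -> d0 (fun c => bound (s c) (t c)).
Proof.
  intros Hs Ht. apply d0_ext with (fun c => exists m, m ≤ t c /\
    exists N, N ≤ t c /\ base (s c) m N /\ t c = pair (pair (s c) m) N).
  - intros c. split.
    + intros (m & N & H & E). exists m. split.
      { rewrite E. eapply le_trans; [| apply le_pair_l]. apply le_pair_r. }
      exists N. split; [rewrite E; apply le_pair_r | auto].
    + intros (m & _ & N & _ & H). exists m, N. exact H.
  - unfold base. definable.
Qed.

(** [divisor_exists] yields a representing triple, and the least number principle the code. The
    bound [b] does not depend on [A], so quantifiers over such finite sets can be bounded. *)
Lemma finite_set k b (A : num M -> Prop) :
  bound k b -> d0 (fun c : ctx 1 => A (snd c)) ->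
  exists c, c ≤ b /\ fin_code c /\ forall i, fin_mem i c <-> i < k /\ A i.
Proof.
  intros (m & N & HB & ->) HA.
  destruct (divisor_exists HB HA) as (n & Hn & Hdvd).
  assert (E : forall i, fin_mem i (pair (pair k m) n) <-> i < k /\ A i).
  { intros i. split.
    - intros (k' & m' & n' & E & Hi & D). apply pair_inj in E as [E ->].
      apply pair_inj in E as [-> ->]. split; auto. apply Hdvd; auto.
    - intros [Hi Ai]. exists k, m, n. repeat split; auto. apply Hdvd; auto. }
  destruct (least (A := fun c => triple c /\
      (forall i, i < c -> fin_mem i c -> i < k /\ A i) /\
      (forall i, i < k -> A i -> fin_mem i c))) as (c & (Tc & H1 & H2) & Hc).
  - definable; apply d0_triple; definable.
  - exists (pair (pair k m) n). split; [exists k, m, n; reflexivity |].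
    split; intros i; [rewrite E; auto |]. intros; apply E; auto.
  - assert (Ec : forall i, fin_mem i c <-> i < k /\ A i).
    { intros i. split.
      - intros Hi. apply H1; auto. apply fin_mem_lt; auto.
      - intros [Hi Ai]; auto. }
    exists c. split; [| split; [split |]]; auto.
    + eapply le_trans; [| apply le_pair; [apply le_refl | exact Hn]].
      apply not_lt. intros L. apply (Hc _ L). split; [exists k, m, n; reflexivity |].
      split; intros i; [rewrite E; auto |]. intros; apply E; auto.
    + intros d Hd Td Ed. apply (Hc d Hd). split; auto.
      split; intros i; rewrite Ed, Ec; auto.
Qed.

Definition bits s l : Prop :=
  seq_length s l /\ forall i j, entry s i j -> j = zero \/ j = one.

(** A bounded form: for values zero and one, unique existence of an entry says that exactly one of
    the two values occurs. *)
Lemma bitsE s l : bits s l <->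
  fin_code s /\
  (forall x, x < s -> fin_mem x s -> exists i, i < l /\ exists j, j ≤ one /\
    x = pair i j) /\
  (forall i, i < l -> (entry s i one <-> ~ entry s i zero)).
Proof.
  assert (Z : @zero M ≤ one) by apply le0n.
  assert (O : forall j : num M, j ≤ one -> j = zero \/ j = one).
  { intros j. rewrite ltS. intros [H|H]; auto. left.
    apply le_antisym; [rewrite add0n; exact H | apply le0n]. }
  split.
  - intros ((Hc & Hp & Hf) & H01). split; [auto | split].
    + intros x _ Hx. destruct (Hp x Hx) as (i & j & Hi & ->). exists i.
      split; auto. exists j. split; auto.
      destruct (H01 i j Hx) as [-> | ->]; [exact Z | apply le_refl].
    + intros i Hi. destruct (Hf i Hi) as (j & Hj & Hu). split.
      * intros H1 H0. apply Hu in H1. apply Hu in H0. subst.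
        apply (@succ_neq0 M _ zero). rewrite add0n. exact H0.
      * intros H0. destruct (H01 i j Hj) as [-> | ->]; tauto.
  - intros (Hc & Hp & Hb). split; [split; [auto | split] |].
    + intros x Hx. destruct (Hp x (fin_mem_lt Hx) Hx) as (i & Hi & j & _ & E).
      exists i, j. auto.
    + intros i Hi. specialize (Hb i Hi).
      assert (K : forall j, entry s i j -> j = zero \/ j = one).
      { intros j Hj. destruct (Hp _ (fin_mem_lt Hj) Hj) as (i' & _ & j' & Lj & E).
        apply pair_inj in E as [_ ->]. auto. }
      destruct (classic (entry s i zero)) as [H0|H0].
      * exists zero. split; auto. intros j Hj.
        destruct (K j Hj) as [-> | ->]; tauto.
      * exists one. split; [tauto |]. intros j Hj.
        destruct (K j Hj) as [-> | ->]; tauto.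
    + intros i j Hj. destruct (Hp _ (fin_mem_lt Hj) Hj) as (i' & _ & j' & Lj & E).
      apply pair_inj in E as [_ ->]. auto.
Qed.

Lemma d0_bits (k : nat) (s t : @ctx M k -> num M) :
  tm s -> tm t -> d0 (fun c => bits (s c) (t c)).
Proof.
  intros Hs Ht. eapply d0_ext; [intros c; apply bitsE |].
  definable. apply d0_fin_code. definable.
Qed.

Ltac definable_derived ::=
  first [apply d0_dvd | apply d0_fin_mem | apply d0_bits | apply d0_bound].

Lemma bits_zero s l i : bits s l -> i < l -> (entry s i zero <-> ~ entry s i one).
Proof.
  intros H Hi. apply bitsE in H as (_ & _ & H). specialize (H i Hi).
  split; [tauto |]. intros K. apply NNPP. tauto.
Qed.

Lemma bits_entry s l i j : bits s l -> entry s i j -> i < l.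
Proof.
  intros ((_ & H & _) & _) K. destruct (H _ K) as (i' & j' & Hi & E).
  apply pair_inj in E as [-> _]. exact Hi.
Qed.

Lemma bits_ext s t l : bits s l -> bits t l ->
  (forall i, i < l -> (entry s i one <-> entry t i one)) -> s = t.
Proof.
  intros Hs Ht H.
  assert (K : forall s t, bits s l -> bits t l ->
    (forall i, i < l -> (entry s i one <-> entry t i one)) ->
    forall x, fin_mem x s -> fin_mem x t).
  { clear s t Hs Ht H. intros s t Hs Ht H x Hx.
    destruct (proj1 (proj2 (proj1 Hs)) x Hx) as (i & j & Hi & ->).
    specialize (H i Hi).
    destruct (proj2 Hs i j Hx) as [-> | ->].
    - apply (bits_zero Ht Hi). apply (bits_zero Hs Hi) in Hx. tauto.
    - apply H. exact Hx. }
  apply fin_code_inj; [apply Hs | apply Ht |]. intros x. split; apply K; auto.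
  intros i Hi. symmetry. auto.
Qed.

Lemma bits_length s l l' : bits s l -> bits s l' -> l = l'.
Proof.
  enough (K : forall l l', bits s l -> bits s l' -> ~ l < l').
  { intros H H'. destruct (lt_total l l') as [L|[L|L]]; auto.
    - destruct (K _ _ H H' L).
    - destruct (K _ _ H' H L). }
  clear l l'. intros l l' H [(_ & _ & H') _] L. destruct (H' l L) as (j & Hj & _).
  apply (bits_entry H) in Hj. exact (lt_irrefl Hj).
Qed.

(** A sequence of [l] bits is thus a subset of the numbers below [pair l (one + one)]; hence the
    argument of [bound] in what follows. *)
Lemma lt_pair_bit i j l : i < l -> j ≤ one -> pair i j < pair l (one + one).
Proof.
  intros Hi Hj. apply pair_lt. apply ltE in Hi as [z ->]. apply leE in Hj as [w E].
  rewrite E at 2. apply ltE. exists (z + w + one). ring.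
Qed.

Lemma bits_exists l b (A : num M -> Prop) :
  bound (pair l (one + one)) b -> d0 (fun c : ctx 1 => A (snd c)) ->
  exists s, s ≤ b /\ bits s l /\ forall i, i < l -> (entry s i one <-> A i).
Proof.
  intros Hb HA.
  assert (N01 : @zero M <> one).
  { intros E. apply (@succ_neq0 M _ zero). rewrite add0n. auto. }
  destruct (finite_set (k := pair l (one + one)) (b := b)
    (A := fun x => exists i, i < l /\
      ((x = pair i one /\ A i) \/ (x = pair i zero /\ ~ A i))))
    as (s & Hs & Hc & H); [exact Hb | definable |].
  assert (E1 : forall i, i < l -> (entry s i one <-> A i)).
  { intros i Hi. unfold entry. rewrite H. split.
    - intros (_ & i' & _ & [[E Ai]|[E _]]); apply pair_inj in E as [-> E]; auto.
      destruct N01. auto.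
    - intros Ai. split; [apply lt_pair_bit; auto; apply le_refl |].
      exists i. auto. }
  assert (E0 : forall i, i < l -> (entry s i zero <-> ~ A i)).
  { intros i Hi. unfold entry. rewrite H. split.
    - intros (_ & i' & _ & [[E _]|[E Ai]]); apply pair_inj in E as [-> E]; auto.
    - intros Ai. split; [apply lt_pair_bit; auto; apply le0n |].
      exists i. auto. }
  exists s. split; [auto | split; [| auto]]. apply bitsE.
  split; [auto | split].
  - intros x _ Hx. apply H in Hx as (_ & i & Hi & [[E _]|[E _]]);
      exists i; split; auto; eexists; (split; [| exact E]);
      [apply le_refl | apply le0n].
  - intros i Hi. rewrite E1, E0 by auto. split; [tauto | apply NNPP].
Qed.

(** The set coded by [s] is coded anew by [finite_set], below [b]; codes being unique, the new code
    is [s]. *)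
Lemma bits_le s l n b :
  bits s l -> l ≤ n -> bound (pair n (one + one)) b -> s ≤ b.
Proof.
  intros Hs Hl Hb.
  destruct (finite_set (A := fun x => fin_mem x s) Hb) as (c & Hc & Cc & H);
    [definable |].
  rewrite (fin_code_inj (c := s) (d := c)); auto; [apply Hs |].
  intros x. rewrite H. split; [| tauto]. intros Hx. split; auto.
  apply bitsE in Hs as (_ & Hs & _).
  destruct (Hs x (fin_mem_lt Hx) Hx) as (i & Hi & j & Hj & ->).
  apply lt_pair_bit; auto. eapply lt_le_trans; eauto.
Qed.

Lemma length_le s l : bits s l -> l ≤ s.
Proof.
  intros H. destruct (zero_or_succ l) as [->|[k ->]]; [apply le0n |].
  destruct (proj2 (proj2 (proj1 H)) k (le_refl k)) as (j & Hj & _).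
  apply fin_mem_lt in Hj. apply leS_lt. eapply le_lt_trans; [| exact Hj].
  apply le_pair_l.
Qed.

Lemma restriction s l n : bits s l -> n ≤ l -> exists t, bits t n /\
  initial_segment t s /\
  forall i j, i < n -> (entry t i j <-> entry s i j).
Proof.
  intros Hs Hn. destruct (bound_exists (pair n (one + one))) as [b Hb].
  destruct (bits_exists (A := fun i => entry s i one) Hb) as (t & _ & Ht & E);
    [definable |].
  enough (K : forall i j, i < n -> (entry t i j <-> entry s i j)).
  { exists t. split; [auto | split; [| auto]].
    exists n, l. split; [apply Ht |]. split; [apply Hs |].
    split; [apply ltS; exact Hn | exact K]. }
  intros i j Hi.
  assert (Hi' : i < l) by (eapply lt_le_trans; eauto).
  split; intros K.
  - destruct (proj2 Ht i j K) as [-> | ->].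
    + apply (bits_zero Hs Hi'). rewrite <- E by auto.
      apply (bits_zero Ht Hi). exact K.
    + apply E; auto.
  - destruct (proj2 Hs i j K) as [-> | ->].
    + apply (bits_zero Ht Hi). rewrite E by auto.
      apply (bits_zero Hs Hi'). exact K.
    + apply E; auto.
Qed.

(** * Weak König's Lemma and separation *)

Lemma WKL_separation : WKL M -> separation M.
Proof.
  intros wkl A B HA HB disj.
  destruct (s1_binary HA) as (P & HP & EP), (s1_binary HB) as (Q & HQ & EQ).
  (* A node of length [l] has to respect only what is enumerated with witnesses below [l]; this
     makes the tree decidable. *)
  pose (ok s l := bits s l /\ forall i, i < l -> forall x, x < l ->
    (P i x -> entry s i one) /\ (Q i x -> ~ entry s i one)).
  destruct (d0_comprehension (A := fun s => exists l, l ≤ s /\ ok s l))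
    as [T HT]; [unfold ok; definable |].
  destruct (wkl T) as (f & Hf1 & Hf2 & Hf3).
  - split.
    + intros s Hs. apply HT in Hs as (l & _ & Hs & _). exists l. exact Hs.
    + intros s t Hs (l & k & Ht & Hk & Hl & E).
      apply HT in Hs as (k' & _ & Hs & Hok).
      assert (Ek : k = k').
      { apply (bits_length (s := s)); auto. split; [exact Hk | apply Hs]. }
      subst k'. assert (Hl' : l ≤ k) by (apply ltS; exact Hl).
      assert (Bt : bits t l).
      { split; auto. intros i j Hj. apply (proj2 Hs i j). apply E; auto.
        destruct (proj1 (proj2 Ht) _ Hj) as (i' & j' & Hi & Eq).
        apply pair_inj in Eq as [-> _]. exact Hi. }
      apply HT. exists l. split; [apply length_le; exact Bt |].
      split; auto. intros i Hi x Hx.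
      rewrite (E i one Hi).
      apply Hok; eapply lt_le_trans; eauto.
  - intros k. destruct (bound_exists (pair k (one + one))) as [b Hb].
    (* A node at level [k] has bit one exactly where a witness of [P] below [k] is found. *)
    destruct (bits_exists (A := fun i => exists x, x < k /\ P i x) Hb)
      as (s & _ & Hs & E); [definable |].
    exists s. rewrite <- ltS. split; [| apply length_le; auto].
    apply HT. exists k. split; [apply length_le; auto |]. split; auto.
    intros i Hi x Hx. split; intros K.
    + apply E; eauto.
    + rewrite E by auto. intros (y & _ & Hy). apply (disj i).
      split; [apply EP | apply EQ]; eauto.
  - destruct (d0_comprehension (A := fun i => pair i one ∈ f)) as [X HX];
      [definable |].
    exists X. intros i. rewrite HX.
    assert (K : forall x, (P i x -> rel f i one) /\ (Q i x -> ~ rel f i one)).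
    (* This length exceeds both the position [i] and the witness [x]. *)
    { intros x. destruct (Hf3 (i + x + one)) as (s & Hs & Hl & E).
      apply HT in Hs as (l & _ & Hs & Hok).
      assert (El : l = i + x + one).
      { apply (bits_length (s := s)); auto. split; [exact Hl | apply Hs]. }
      subst l. rewrite <- E by apply le_addr.
      apply Hok; [apply le_addr | apply le_addl]. }
    split; intros H.
    + apply EP in H as [x Hx]. apply (K x). exact Hx.
    + apply EQ in H as [x Hx]. apply (K x). exact Hx.
Qed.

(** * From separation to Weak König's Lemma *)

Section SeparationWKL.

Variables (T X : sets M).

Definition agree s t j : Prop :=
  forall i, i < j -> (entry s i one <-> entry t i one).

(* Some node of [T] of length [n] extends the first [j] bits of [s] followed by
   the bit [v]; here [b] bounds the codes of binary sequences of length [n]. *)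
Definition live s j n b v : Prop :=
  exists t, t ≤ b /\ t ∈ T /\ bits t n /\ agree s t j /\ entry t j v.

(** With the bound [b] at hand [live] is bounded, so its negation is harmless and [dies] is [s1]. *)
Definition dies v w s : Prop :=
  exists n b j, bound (pair n (one + one)) b /\ bits s j /\ j < n /\
    live s j n b w /\ ~ live s j n b v.

(** [r] is the initial segment of [s] of length [j], about which [X] is asked for the next bit. *)
Definition follow s l : Prop :=
  bits s l /\ forall j, j < l -> exists r, bits r j /\ agree s r j /\
    (entry s j one <-> r ∈ X).

Hypothesis binT : binary_tree T.
Hypothesis infT : infinite T.

Lemma tree_restriction t l n : t ∈ T -> bits t l -> n ≤ l ->
  exists r, r ∈ T /\ bits r n /\ forall i j, i < n -> (entry r i j <-> entry t i j).
Proof.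
  intros Ht Hb Hn. destruct (restriction Hb Hn) as (r & Hr & Hi & E).
  exists r. split; [| auto]. exact (proj2 binT t r Ht Hi).
Qed.

Lemma live_le s j n b n' b' v :
  n ≤ n' -> j < n -> bound (pair n (one + one)) b ->
  live s j n' b' v -> live s j n b v.
Proof.
  intros Hn Hj Hb (t & _ & Ht & Bt & Hag & Hv).
  destruct (tree_restriction Ht Bt Hn) as (r & Hr & Br & E).
  exists r. split; [exact (bits_le Br (le_refl n) Hb) |].
  split; [auto | split; [auto | split; [| apply E; auto]]].
  intros i Hi. rewrite E by (eapply lt_trans; eauto). apply Hag; auto.
Qed.

(** Liveness passes to lower levels. At the lower of the two levels, the successor said to be dead
    there is live because it is live at the higher one. *)
Lemma dies_disjoint v w s : ~ (dies v w s /\ dies w v s).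
Proof.
  intros [(n & b & j & Hb & Hs & Hj & Lw & Nv)
          (n' & b' & j' & Hb' & Hs' & Hj' & Lv & Nw)].
  pose proof (bits_length Hs' Hs). subst j'.
  destruct (classic (n ≤ n')) as [L|L].
  - apply Nv. eapply live_le; eauto.
  - apply Nw. eapply live_le; [| | | exact Lw]; eauto.
    apply not_lt in L. apply lt_le, lt_leS. exact L.
Qed.

Lemma s1_dies v w : s1 (fun c : ctx 1 => dies v w (snd c)).
Proof. unfold dies, live, agree. sigma. Qed.

(** A node whose code exceeds the bound for length [n] has length at least [n], and can be cut
    down. *)
Lemma tree_level n : exists t, t ∈ T /\ bits t n.
Proof.
  destruct (bound_exists (pair n (one + one))) as [b Hb].
  destruct (infT (b + one)) as (s & Hs & Hbs).
  destruct (proj1 binT s Hs) as (l & Bs).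
  destruct (tree_restriction (n := n) Hs Bs) as (r & Hr & Br & _).
  - apply not_lt. intros L. apply ltS, lt_leS in Hbs.
    apply (lt_irrefl (x := s)). eapply le_lt_trans; [| exact Hbs].
    apply (bits_le Bs (lt_le L) Hb).
  - eauto.
Qed.

Lemma agree_trans r s t j : agree r s j -> agree s t j -> agree r t j.
Proof. intros H K i Hi. rewrite (H i Hi). auto. Qed.

Lemma agree_sym s t j : agree s t j -> agree t s j.
Proof. intros H i Hi. symmetry. auto. Qed.

Lemma follow_exists l : exists s, follow s l.
Proof.
  revert l. apply (s1_ind (A := fun l => exists s, follow s l)).
  - apply s1_ext with (fun c => exists s, bits s (snd c) /\ forall j, j < snd c ->
      exists r, bits r j /\ agree s r j /\ (entry s j one <-> r ∈ X)).
    + reflexivity.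
    + unfold agree. sigma.
  - destruct (bound_exists (pair zero (one + one))) as [b Hb].
    destruct (bits_exists (A := fun i => i = i) Hb) as (s & _ & Hs & _);
      [definable |].
    exists s. split; auto. intros j Hj. destruct (ltn0 Hj).
  - intros l (s & Bs & Hs).
    destruct (bound_exists (pair (l + one) (one + one))) as [b Hb].
    destruct (bits_exists
      (A := fun i => (i < l /\ entry s i one) \/ (i = l /\ s ∈ X)) Hb)
      as (s' & _ & Bs' & E); [definable |].
    assert (Hag : forall j, j ≤ l -> agree s' s j).
    { intros j Hj i Hi. assert (Hil : i < l) by (eapply lt_le_trans; eauto).
      rewrite E by (apply lt_le; exact Hil). split; [| tauto].
      intros [[_ H]|[-> _]]; [exact H | destruct (lt_irrefl Hil)]. }
    exists s'. split; auto. intros j Hj. apply ltS in Hj as [Hj| ->].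
    + destruct (Hs j Hj) as (r & Br & Hr & HX). exists r. split; auto.
      split.
      * eapply agree_trans; [apply Hag, lt_le, Hj | exact Hr].
      * rewrite <- HX. apply (Hag l (le_refl l)). exact Hj.
    + exists s. split; [auto | split; [apply Hag, le_refl |]].
      rewrite E by apply le_refl. split; [| tauto].
      intros [[K _]|[_ K]]; [destruct (lt_irrefl K) | exact K].
Qed.

(** At a first disagreement both sequences have the same initial segment, hence received the same
    answer from [X]. *)
Lemma follow_agree s t l l' j :
  follow s l -> follow t l' -> j ≤ l -> j ≤ l' -> agree s t j.
Proof.
  intros [Bs Hs] [Bt Ht] Hl Hl'. apply NNPP. intros H.
  destruct (least (A := fun i => i < j /\ ~ (entry s i one <-> entry t i one)))
    as (i & [Hi Hd] & Hmin).
  - definable.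
  - apply NNPP. intros K. apply H. intros i Hi. apply NNPP. eauto.
  - apply Hd. destruct (Hs i) as (r & Br & Hr & Er); [eapply lt_le_trans; eauto |].
    destruct (Ht i) as (r' & Br' & Hr' & Er'); [eapply lt_le_trans; eauto |].
    assert (Hst : agree s t i).
    { intros k Hk. apply NNPP. intros K. apply (Hmin k Hk). split; auto.
      eapply lt_trans; eauto. }
    rewrite Er, Er', (bits_ext Br Br'); [reflexivity |].
    apply (agree_trans (agree_sym Hr)). exact (agree_trans Hst Hr').
Qed.

Lemma follow_entry s t l l' i j :
  follow s l -> follow t l' -> i < l' -> entry s i j -> entry t i j.
Proof.
  intros Hs Ht Hi K. assert (Hil : i < l) by apply (bits_entry (proj1 Hs) K).
  assert (E : entry s i one <-> entry t i one).
  { apply (follow_agree (j := i + one) Hs Ht); [apply leS_lt; auto .. | apply le_refl]. }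
  destruct (proj2 (proj1 Hs) i j K) as [-> | ->].
  - apply (bits_zero (proj1 Ht) Hi). rewrite <- E.
    apply (bits_zero (proj1 Hs) Hil). exact K.
  - tauto.
Qed.

Hypothesis X_one : forall s, dies zero one s -> s ∈ X.
Hypothesis X_zero : forall s, dies one zero s -> ~ s ∈ X.

(* Otherwise let [j] be maximal such that [T] has a node of length [n] agreeing
   with [s] below [j]: the choice made at [j] contradicts [X]. *)
Lemma follow_in_tree s n : follow s n -> s ∈ T.
Proof.
  intros [Bs Hs]. apply NNPP. intros nT.
  destruct (bound_exists (pair n (one + one))) as [b Hb].
  destruct (least (A := fun j => ~ exists t, t ≤ b /\ t ∈ T /\ bits t n /\
    agree s t j)) as (j & Hj & Hmin).
  - unfold agree. definable.
  - exists n. intros (t & _ & Ht & Bt & Hag). apply nT.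
    rewrite (bits_ext Bs Bt Hag). exact Ht.
  - destruct (zero_or_succ j) as [->|[i ->]].
    + destruct (tree_level n) as (t & Ht & Bt). apply Hj. exists t.
      split; [exact (bits_le Bt (le_refl n) Hb) |].
      split; [auto | split; auto]. intros i Hi. destruct (ltn0 Hi).
    + assert (K : exists t, t ≤ b /\ t ∈ T /\ bits t n /\ agree s t i).
      { apply NNPP, Hmin, le_refl. }
      destruct K as (t & Htb & Ht & Bt & Hag).
      assert (Hin : i < n).
      { apply NNPP. intros L. apply not_lt in L. apply nT.
        rewrite (bits_ext Bs Bt); auto. intros k Hk. apply Hag.
        eapply lt_le_trans; eauto. }
      (* No node of length [n] agrees with [s] up to and including [i], so the bit of [s] is dead at
         level [n], whereas the bit of [t] is live. *)
      assert (D : forall v w, entry s i v -> entry t i w ->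
        forall r, bits r i -> agree s r i -> dies v w r).
      { intros v w Hv Hw r Br Hr. exists n, b, i.
        split; [auto | split; [auto | split; [auto | split]]].
        - exists t. split; [auto | split; [auto | split; [auto | split; auto]]].
          exact (agree_trans (agree_sym Hr) Hag).
        - intros (u & Hub & Hu & Bu & Hru & Huv). apply Hj. exists u.
          split; [auto | split; [auto | split; [auto |]]].
          intros k Hk. apply ltS in Hk as [Hk| ->].
          + exact (agree_trans Hr Hru Hk).
          + destruct (proj2 Bs i v Hv) as [-> | ->]; [| tauto].
            apply (bits_zero Bs Hin) in Hv. apply (bits_zero Bu Hin) in Huv.
            tauto. }
      assert (N : ~ (entry s i one <-> entry t i one)).
      { intros N. apply Hj. exists t.
        split; [auto | split; [auto | split; [auto |]]].
        intros k Hk. apply ltS in Hk as [Hk| ->]; auto. }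
      destruct (Hs i Hin) as (r & Br & Hr & Er).
      destruct (classic (entry s i one)) as [S1|S0].
      * apply (X_zero (s := r)); [| tauto]. apply (D one zero); auto.
        apply (bits_zero Bt Hin). tauto.
      * apply S0, Er, X_one. apply (D zero one); auto; [| tauto].
        apply (bits_zero Bs Hin). exact S0.
Qed.

End SeparationWKL.
(** The path is the union of all sequences following [X]. Its graph and the complement are both
    [s1], the latter because the value at [i] is decided by any sequence of length [i + one];
    [reduction] makes the graph a set. *)
Lemma separation_WKL : separation M -> WKL M.
Proof.
  intros sep T binT infT.
  destruct (sep (dies T zero one) (dies T one zero)) as [X HX].
  { apply s1_dies. }
  { apply s1_dies. }
  { intros s. apply dies_disjoint. exact binT. }
  assert (inT : forall s n, follow X s n -> s ∈ T).
  { intros s n. apply follow_in_tree; auto; intros r; apply HX. }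
  destruct (reduction
    (A := fun x => exists i, exists j, exists s,
      x = pair i j /\ follow X s (i + one) /\ entry s i j)
    (B := fun x =>
      (forall i, i ≤ x -> forall j, j ≤ x -> x <> pair i j) \/
      exists i, exists j, exists s,
        x = pair i j /\ follow X s (i + one) /\ ~ entry s i j))
    as [f Hf].
  - unfold follow, agree. sigma.
  - unfold follow, agree. sigma.
  - intros x. destruct (classic (exists i j, x = pair i j)) as [(i & j & ->)|H].
    + destruct (follow_exists X (i + one)) as [s Hs].
      destruct (classic (entry s i j)) as [K|K]; [left | right; right];
        exists i, j, s; auto.
    + right; left. intros i _ j _ E. eauto.
  - assert (E : forall s l i j, follow X s l -> i < l ->
      (rel f i j <-> entry s i j)).
    { intros s l i j Hs Hi. unfold rel. split; intros K.
      - apply Hf in K as (i' & j' & t & E & Ht & K). apply pair_inj in E as [<- <-].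
        exact (follow_entry Ht Hs Hi K).
      - apply NNPP. intros nK. apply Hf in nK as [nK|(i' & j' & t & E & Ht & nK)].
        + apply (nK i (le_pair_l i j) j (le_pair_r i j)). reflexivity.
        + apply pair_inj in E as [<- <-]. apply nK.
          exact (follow_entry Hs Ht (le_refl i) K). }
    exists f. split; [| split].
    + intros x Hx. apply Hf in Hx as (i & j & s & -> & Hs & K).
      exists i, j. split; auto. apply (proj2 (proj1 Hs) i j K).
    + intros i. destruct (follow_exists X (i + one)) as [s Hs].
      destruct (proj2 (proj2 (proj1 (proj1 Hs))) i (le_refl i)) as (j & Hj & Hu).
      exists j. split.
      * apply (E s (i + one)); auto. apply le_refl.
      * intros j' Hj'. apply Hu. apply (E s (i + one)); auto. apply le_refl.
    + intros n. destruct (follow_exists X n) as [s Hs]. exists s.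
      split; [eauto | split; [apply Hs |]].
      intros i j Hi. rewrite (E s n); auto. reflexivity.
Qed.

End Coding.

(** * Representing orders that omit 2+2 *)

Section LinearExtension.

Context {M : L2_structure} {hM : RCA0 M}.
Implicit Types a b i j k l m n p q r s t u v w x y z : num M.

(** [kind] will tell left from right endpoints, and [R x y] will say that [x] is forced to precede
    [y], an endpoint of the other kind. Excluding cycles of four amounts to omitting 2+2. *)
Variables (R : num M -> num M -> Prop) (kind : num M -> Prop).
Hypothesis R_d0 : d0 (fun c : ctx 2 => R (snd (fst c)) (snd c)).
Hypothesis R_kind : forall x y, R x y -> ~ (kind x <-> kind y).
Hypothesis R_total : forall x y, ~ (kind x <-> kind y) -> R x y \/ R y x.
Hypothesis R_acyclic : forall x y z w, R x y -> R y z -> R z w -> ~ R w x.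

(** Chains of two compare endpoints of the same kind. Longer chains add nothing: by [R_total] and
    [R_acyclic] a chain of three reduces to a single [R]. *)
Definition prec x y : Prop := R x y \/ exists r, R x r /\ R r y.

(** A cycle of two, traversed twice, is one of four; cycles of three are impossible because [R]
    alternates kinds. *)
Lemma prec_asym x y : ~ (prec x y /\ prec y x).
Proof.
  intros [[H|(r & H & H')] [K|(s & K & K')]].
  - exact (R_acyclic H K H K).
  - apply R_kind in H, K, K'. tauto.
  - apply R_kind in H, H', K. tauto.
  - exact (R_acyclic H H' K K').
Qed.

(** Negative transitivity, which together with asymmetry gives a strict weak order. [R_total]
    compares [a] with endpoints of the other kind; each unwanted outcome puts [b] before [a] or
    closes a cycle of four. *)
Lemma prec_weak a b c : prec b c -> ~ prec b a -> prec a c.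
Proof.
  intros H N. unfold prec in *.
  destruct H as [H|(r & H & H')].
  - pose proof (R_kind H).
    destruct (classic (kind a <-> kind b)) as [E|E].
    + destruct (R_total (x := a) (y := c)) as [K|K]; [tauto | auto |].
      destruct N. eauto.
    + destruct (R_total (x := a) (y := b)) as [K|K]; [tauto | eauto | tauto].
  - pose proof (R_kind H). pose proof (R_kind H').
    destruct (classic (kind a <-> kind b)) as [E|E].
    + destruct (R_total (x := a) (y := r)) as [K|K]; [tauto | eauto |].
      destruct N. eauto.
    + destruct (R_total (x := a) (y := b)) as [K|K]; [tauto | | tauto].
      destruct (R_total (x := a) (y := c)) as [K'|K']; [tauto | auto |].
      destruct (R_acyclic K H H' K').
Qed.

Section Lexicographic.

Variable X : sets M.
Hypothesis X_prec : forall x y, prec x y -> pair x y ∈ X.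
Hypothesis X_succ : forall x y, prec y x -> ~ pair x y ∈ X.

(* A tournament extending [prec], which need not be transitive. *)
Definition below x y : Prop :=
  x = y \/ (x < y /\ pair x y ∈ X) \/ (y < x /\ ~ pair y x ∈ X).

Lemma below_total x y : x <> y -> (below x y <-> ~ below y x).
Proof.
  unfold below. intros N. pose proof (@lt_irrefl M hM) as I.
  destruct (lt_total x y) as [L|[L|L]]; [| tauto |].
  - assert (~ y < x) by (intros K; apply (I x), (lt_trans L K)).
    assert (y <> x) by auto. tauto.
  - assert (~ x < y) by (intros K; apply (I x), (lt_trans K L)).
    assert (y <> x) by auto. tauto.
Qed.

Lemma prec_below x y : prec x y -> below x y.
Proof.
  intros H. destruct (lt_total x y) as [L|[L|L]].
  - right; left. auto.
  - left. exact L.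
  - right; right. auto.
Qed.

Lemma prec_not_below x y : prec y x -> ~ below x y.
Proof.
  intros H. rewrite below_total; [intros K; apply K, prec_below, H |].
  intros ->. exact (prec_asym (conj H H)).
Qed.

Definition lex x y : Prop :=
  exists m, ~ below m x /\ below m y /\
    forall k, k < m -> (below k x <-> below k y).

(** Agreement at both [x] and [y] would give [below x y] and [below y x], so distinct numbers
    already differ at one of these two places. This bound makes [lex] [d0]. *)
Lemma lexE x y : lex x y <-> exists m, m ≤ x + y /\ ~ below m x /\ below m y /\
    forall k, k < m -> (below k x <-> below k y).
Proof.
  split; [| intros (m & _ & H); exists m; exact H].
  intros (m & Nx & Hy & Hm). exists m. split; auto.
  apply not_lt. intros L.
  assert (Lx : x < m) by (eapply le_lt_trans; [apply le_addr | exact L]).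
  assert (Ly : y < m) by (eapply le_lt_trans; [apply le_addl | exact L]).
  assert (N : x <> y) by (intros ->; tauto).
  apply (below_total N).
  - apply Hm; auto. left. reflexivity.
  - apply Hm; auto. left. reflexivity.
Qed.

Lemma d0_lex (k : nat) (s t : @ctx M k -> num M) :
  tm s -> tm t -> d0 (fun c => lex (s c) (t c)).
Proof.
  intros Hs Ht. eapply d0_ext; [intros c; apply lexE |].
  unfold below. definable.
Qed.

Lemma lex_asym x y : lex x y -> ~ lex y x.
Proof.
  intros (m & H1 & H2 & H3) (n & K1 & K2 & K3).
  destruct (lt_total m n) as [L|[<-|L]].
  - specialize (K3 m L). tauto.
  - tauto.
  - specialize (H3 n L). tauto.
Qed.

Lemma lex_trans x y z : lex x y -> lex y z -> lex x z.
Proof.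
  intros (m & H1 & H2 & H3) (n & K1 & K2 & K3).
  destruct (lt_total m n) as [L|[<-|L]]; [| tauto |].
  - exists m. split; [auto | split; [apply K3; auto |]]. intros k Hk.
    rewrite H3 by auto. apply K3. eapply lt_trans; eauto.
  - exists n. split; [rewrite H3; auto | split; [auto |]]. intros k Hk.
    rewrite <- K3 by auto. apply H3. eapply lt_trans; eauto.
Qed.

Lemma lex_total x y : x <> y -> lex x y \/ lex y x.
Proof.
  intros N.
  destruct (least (A := fun m => ~ (below m x <-> below m y))) as (m & Hm & Hmin).
  - unfold below. definable.
  - destruct (classic (below x y)) as [K|K].
    + exists y. intros E. apply (below_total N); auto. apply E. left. reflexivity.
    + exists x. intros E. apply K, E. left. reflexivity.
  - assert (Hmin' : forall k, k < m -> (below k x <-> below k y)).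
    { intros k Hk. apply NNPP. auto. }
    destruct (classic (below m x)) as [K|K]; [right | left]; exists m.
    + split; [tauto | split; [auto |]]. intros k Hk. symmetry. auto.
    + split; [auto | split; [tauto |]]. auto.
Qed.

(** If [m] decided for [lex y x], then [below m x] excludes [prec x m], so [prec_weak] gives
    [prec m y] and hence [below m y], a contradiction. *)
Lemma lex_prec x y : prec x y -> lex x y.
Proof.
  intros H. destruct (lex_total (x := x) (y := y)) as [K|(m & K1 & K2 & _)]; auto.
  - intros ->. exact (prec_asym (conj H H)).
  - destruct K1. apply prec_below. apply prec_weak with x; auto.
    intros P. exact (prec_not_below P K2).
Qed.

End Lexicographic.

Lemma linear_extension (sep : separation M) (U : sets M) :
  (forall x, x ∈ U) ->
  exists Le, linear_order U Le /\ forall x y, R x y -> strict Le x y.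
Proof.
  intros HU.
  destruct (sep (fun n => exists x, exists y, n = pair x y /\ prec x y)
    (fun n => exists x, exists y, n = pair x y /\ prec y x)) as [X HX].
  { unfold prec. sigma. }
  { unfold prec. sigma. }
  { intros n [(x & y & -> & H) (x' & y' & E & K)]. apply pair_inj in E as [<- <-].
    exact (prec_asym (conj H K)). }
  assert (X1 : forall x y, prec x y -> pair x y ∈ X) by (intros; apply HX; eauto).
  assert (X2 : forall x y, prec y x -> ~ pair x y ∈ X) by (intros; apply HX; eauto).
  assert (D : forall (k : nat) (s t : @ctx M k -> num M), tm s -> tm t ->
    d0 (fun c => lex X (s c) (t c))) by (intros; apply d0_lex; auto).
  destruct (d0_comprehension (A := fun n => exists x, x ≤ n /\ exists y, y ≤ n /\
    n = pair x y /\ (x = y \/ lex X x y))) as [Le HLe].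
  { definable. apply D; definable. }
  assert (E : forall x y, rel Le x y <-> x = y \/ lex X x y).
  { intros x y. unfold rel. rewrite HLe. split.
    - intros (x' & _ & y' & _ & E & H). apply pair_inj in E as [<- <-]. exact H.
    - intros H. exists x. split; [apply le_pair_l |]. exists y.
      split; [apply le_pair_r | auto]. }
  exists Le. split; [split; [split; [| split; [| split]] |] |].
  - intros n Hn. apply HLe in Hn as (x & _ & y & _ & H & _). exists x, y. auto.
  - intros p _. apply E. auto.
  - intros p q r. rewrite !E. intros [->|H] [->|K]; auto. right.
    eapply lex_trans; eauto.
  - intros p q. rewrite !E. intros [->|H] [K|K]; auto.
    destruct (lex_asym H K).
  - intros x y _ _. rewrite !E. destruct (classic (x = y)); auto.
    destruct (lex_total X (x := x) (y := y)); auto.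
  - intros x y H. assert (K : lex X x y) by (apply lex_prec; auto; left; auto).
    split; [apply E; auto |]. intros ->. exact (lex_asym K K).
Qed.

End LinearExtension.

(** * Closed intervals from a linear order of the endpoints *)

Section Representation.

Context {M : L2_structure} {hM : RCA0 M}.
Implicit Types i j k l m n p q r s t u v w x y z : num M.

Add Ring num_ring : (@num_semiring M hM).

(* The endpoints of the interval assigned to [p]. *)
Definition left_end p : num M := p + p.
Definition right_end p : num M := p + p + one.

Lemma left_or_right x : exists p, p ≤ x /\ (x = left_end p \/ x = right_end p).
Proof.
  unfold left_end, right_end. revert x. apply d0_ind; [definable | |].
  - exists zero. split; [apply le_refl | left; ring].
  - intros x (p & Hp & [->| ->]).
    + exists p. split; [apply lt_le; exact Hp | auto].
    + exists (p + one). split; [| left; ring]. apply leE. exists (p + one). ring.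
Qed.

Lemma left_inj p q : left_end p = left_end q -> p = q.
Proof.
  unfold left_end. intros E. destruct (lt_total p q) as [L|[L|L]]; auto;
    apply ltE in L as [z L]; exfalso.
  - apply (@succ_neq0 M _ (z + z + one)), addnI with (p + p).
    transitivity (q + q); [rewrite L; ring | rewrite E; ring].
  - apply (@succ_neq0 M _ (z + z + one)), addnI with (q + q).
    transitivity (p + p); [rewrite L; ring | rewrite E; ring].
Qed.

Lemma right_inj p q : right_end p = right_end q -> p = q.
Proof. intros E. apply succ_inj in E. exact (left_inj E). Qed.

Lemma left_neq_right p q : left_end p <> right_end q.
Proof.
  unfold left_end, right_end. intros E.
  destruct (classic (q < p)) as [L|L].
  - apply ltE in L as [z ->]. apply (@succ_neq0 M _ (z + z)), addnI with (q + q + one).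
    transitivity (q + z + one + (q + z + one)); [ring | rewrite E; ring].
  - apply not_lt, leE in L as [z ->]. apply (@succ_neq0 M _ (z + z)), addnI with (p + p).
    transitivity (p + z + (p + z) + one); [ring | rewrite <- E; ring].
Qed.

(** Every number is an endpoint, also of some [p] outside [P]. Such a [p] is strictly comparable to
    nothing, which leaves the forced comparisons total and acyclic. *)
Lemma closed_rep_exists (sep : separation M) (P le : sets M) :
  partial_order P le -> omits_2_plus_2 P le ->
  exists L leL f0 f1, closed_rep P le L leL f0 f1 /\
    (forall x, x ∈ L) /\
    (forall p x, rel f0 p x <-> p ∈ P /\ x = left_end p) /\
    (forall p x, rel f1 p x <-> p ∈ P /\ x = right_end p).
Proof.
  intros (Pon & Prefl & Ptrans & Panti) Hom.
  assert (inP : forall p q, strict le p q -> p ∈ P /\ q ∈ P).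
  { intros p q [H _]. apply Pon in H as (i & j & Hi & Hj & E).
    apply pair_inj in E as [-> ->]. auto. }
  assert (Strans : forall p q r, strict le p q -> rel le q r -> strict le p r).
  { intros p q r [H N] K. split; [eauto |]. intros ->. apply N, Panti; auto. }
  assert (Strans' : forall p q r, rel le p q -> strict le q r -> strict le p r).
  { intros p q r H [K N]. split; [eauto |]. intros ->. apply N, Panti; auto. }
  assert (Hom' : forall p0 q0 p1 q1, strict le p0 q0 -> strict le p1 q1 ->
    strict le p0 q1 \/ strict le p1 q0).
  { intros p0 q0 p1 q1 H K. pose proof (inP _ _ H). pose proof (inP _ _ K).
    destruct (classic (p0 = q1)) as [->|N].
    { right. destruct K; eauto. }
    destruct (classic (p1 = q0)) as [->|N'].
    { left. destruct H. eauto. }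
    destruct (Hom p0 q0 p1 q1) as [E|E]; try tauto; [left | right]; split; auto. }
  (* The right end of [p] precedes the left end of [q] if [p] is below [q], and the left end of [p]
     precedes the right end of [q] unless [q] is below [p]. *)
  pose (R x y := exists p, p ≤ x /\ exists q, q ≤ y /\
    ((x = right_end p /\ y = left_end q /\ strict le p q) \/
     (x = left_end p /\ y = right_end q /\ ~ strict le q p))).
  assert (R_rl : forall p q, R (right_end p) (left_end q) <-> strict le p q).
  { intros p q. split.
    - intros (p' & _ & q' & _ & [(E & E' & H)|(E & _)]).
      + apply right_inj in E as <-. apply left_inj in E' as <-. exact H.
      + destruct (left_neq_right (eq_sym E)).
    - intros H. exists p. split; [apply lt_le, leE; exists p; reflexivity |].
      exists q. split; [apply le_addl |]. auto. }
  assert (R_lr : forall p q, R (left_end p) (right_end q) <-> ~ strict le q p).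
  { intros p q. split.
    - intros (p' & _ & q' & _ & [(E & _)|(E & E' & H)]).
      + destruct (left_neq_right E).
      + apply left_inj in E as <-. apply right_inj in E' as <-. exact H.
    - intros H. exists p. split; [apply le_addl |].
      exists q. split; [apply lt_le, leE; exists q; reflexivity |]. auto. }
  assert (R_ll : forall p q, ~ R (left_end p) (left_end q)).
  { intros p q (p' & _ & q' & _ & [(E & _)|(_ & E & _)]); exact (left_neq_right E). }
  assert (R_rr : forall p q, ~ R (right_end p) (right_end q)).
  { intros p q (p' & _ & q' & _ & [(_ & E & _)|(E & _)]);
      exact (left_neq_right (eq_sym E)). }
  destruct (d0_comprehension (A := fun x => x = x)) as [L HL]; [definable |].
  assert (HL' : forall x, x ∈ L) by (intros x; apply HL; reflexivity).
  pose (kind x := exists p, x = left_end p).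
  assert (kl : forall p, kind (left_end p)) by (intros p; exists p; auto).
  assert (kr : forall p, ~ kind (right_end p)).
  { intros p [q E]. exact (left_neq_right (eq_sym E)). }
  destruct (linear_extension (R := R) (kind := kind)) with (U := L)
    as (leL & HleL & HR); auto.
  - unfold R, left_end, right_end, strict. definable.
  - intros x y (p & _ & q & _ & [(-> & -> & _)|(-> & -> & _)]);
      pose proof (kl q); pose proof (kl p); pose proof (kr p); pose proof (kr q);
      tauto.
  - intros x y. destruct (left_or_right x) as (p & _ & [->| ->]),
      (left_or_right y) as (q & _ & [->| ->]);
      pose proof (kl q); pose proof (kl p); pose proof (kr p); pose proof (kr q);
      rewrite ?R_rl, ?R_lr; try tauto;
      intros _; destruct (classic (strict le p q)), (classic (strict le q p)); tauto.
  (* A cycle alternates between left and right ends; its two strict comparisons and two denied ones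
     form a 2+2. *)
  - intros x y z w H1 H2 H3 H4.
    destruct (left_or_right x) as (p & _ & [->| ->]),
      (left_or_right y) as (q & _ & [->| ->]);
      try solve [eapply R_ll; eauto | eapply R_rr; eauto];
      destruct (left_or_right z) as (r & _ & [->| ->]);
      try solve [eapply R_ll; eauto | eapply R_rr; eauto];
      destruct (left_or_right w) as (s & _ & [->| ->]);
      try solve [eapply R_ll; eauto | eapply R_rr; eauto];
      rewrite ?R_rl, ?R_lr in *.
    + destruct (Hom' q r s p); tauto.
    + destruct (Hom' p q r s); tauto.
  - destruct (d0_comprehension (A := fun n => exists p, p ≤ n /\
      (n = pair p (left_end p) /\ p ∈ P))) as [f0 Hf0]; [unfold left_end; definable |].
    destruct (d0_comprehension (A := fun n => exists p, p ≤ n /\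
      (n = pair p (right_end p) /\ p ∈ P))) as [f1 Hf1]; [unfold right_end; definable |].
    assert (E0 : forall p x, rel f0 p x <-> p ∈ P /\ x = left_end p).
    { intros p x. unfold rel. rewrite Hf0. split.
      - intros (p' & _ & E & Hp). apply pair_inj in E as [<- E]. auto.
      - intros [Hp ->]. exists p. split; [apply le_pair_l | auto]. }
    assert (E1 : forall p x, rel f1 p x <-> p ∈ P /\ x = right_end p).
    { intros p x. unfold rel. rewrite Hf1. split.
      - intros (p' & _ & E & Hp). apply pair_inj in E as [<- E]. auto.
      - intros [Hp ->]. exists p. split; [apply le_pair_l | auto]. }
    exists L, leL, f0, f1. split; [| auto].
    assert (Sasym : forall x y, strict leL x y -> ~ strict leL y x).
    { destruct HleL as [(_ & _ & _ & anti) _]. intros x y [H N] [K _]. eauto. }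
    split; [auto | split; [| split; [| split]]].
    + split.
      * intros n Hn. apply Hf0 in Hn as (p & _ & -> & Hp). exists p, (left_end p). auto.
      * intros p Hp. exists (left_end p). split; [apply E0; auto |].
        intros x Hx. apply E0 in Hx as [_ ->]. reflexivity.
    + split.
      * intros n Hn. apply Hf1 in Hn as (p & _ & -> & Hp). exists p, (right_end p). auto.
      * intros p Hp. exists (right_end p). split; [apply E1; auto |].
        intros x Hx. apply E1 in Hx as [_ ->]. reflexivity.
    + intros p x0 x1 Hp H0 H1. apply E0 in H0 as [_ ->]. apply E1 in H1 as [_ ->].
      apply HR, R_lr. intros [_ N]. tauto.
    + intros p q x y Hp Hq H1 H0. apply E0 in H0 as [_ ->]. apply E1 in H1 as [_ ->].
      split.
      * intros H. apply HR, R_rl, H.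
      * intros H. apply NNPP. intros N. apply R_lr, HR in N.
        exact (Sasym _ _ H N).
Qed.

Lemma separation_distinguishing (sep : separation M) (P le : sets M) :
  partial_order P le -> omits_2_plus_2 P le -> distinguishing_interval_order P le.
Proof.
  intros HP Hom. destruct (closed_rep_exists sep HP Hom)
    as (L & leL & f0 & f1 & Hrep & _ & E0 & E1).
  exists L, leL, f0, f1. split; [exact Hrep |].
  intros f [|] [|] p q x y Hp Hq N Hx Hy; unfold f in *; rewrite ?E0, ?E1 in *;
    destruct Hx as [_ ->], Hy as [_ ->].
  - intros E. apply right_inj in E. destruct N; auto.
  - intros E. exact (left_neq_right (eq_sym E)).
  - apply left_neq_right.
  - intros E. apply left_inj in E. destruct N; auto.
Qed.

(** The closed intervals between the endpoints serve as [F]. If two are equal as sets, each contains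
    the least element of the other, so their left endpoints coincide. *)
Lemma separation_one_one (sep : separation M) (P le : sets M) :
  partial_order P le -> omits_2_plus_2 P le -> one_one_interval_order P le.
Proof.
  intros HP Hom. destruct (closed_rep_exists sep HP Hom)
    as (L & leL & f0 & f1 & (Hlin & _ & _ & C1 & C2) & HL & E0 & E1).
  pose proof Hlin as [(_ & refl & trans & anti) total].
  destruct (d0_comprehension (A := fun n => exists p, p ≤ n /\ exists x, x ≤ n /\
    n = pair p x /\ p ∈ P /\ rel leL (left_end p) x /\ rel leL x (right_end p)))
    as [F HF]; [unfold left_end, right_end; definable |].
  assert (EF : forall p x, rel F p x <->
    p ∈ P /\ rel leL (left_end p) x /\ rel leL x (right_end p)).
  { intros p x. unfold rel at 1. rewrite HF. split.
    - intros (p' & _ & x' & _ & E & H). apply pair_inj in E as [<- <-]. exact H.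
    - intros H. exists p. split; [apply le_pair_l |]. exists x.
      split; [apply le_pair_r | auto]. }
  assert (lr : forall p, p ∈ P -> rel leL (left_end p) (right_end p)).
  { intros p Hp. apply (C1 p); [exact Hp | apply E0 | apply E1]; auto. }
  exists L, leL, F. split; [split; [exact Hlin | split; [| split]] |].
  - intros n Hn. apply HF in Hn as (p & _ & x & _ & -> & Hp & _). exists p, x. auto.
  - intros p Hp. split; [exists (left_end p); apply EF; auto |].
    intros x y z Hx Hy [H _] [K _]. apply EF in Hx as (_ & Hx & _).
    apply EF in Hy as (_ & _ & Hy). apply EF. eauto.
  - intros p q Hp Hq.
    assert (E : strict le p q <-> strict leL (right_end p) (left_end q)).
    { apply C2; auto; [apply E1 | apply E0]; auto. }
    rewrite E. split.
    + intros [H N] x y Hx Hy. apply EF in Hx as (_ & _ & Hx).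
      apply EF in Hy as (_ & Hy & _). split; [eauto |].
      intros ->. apply N, anti; eauto.
    + intros H. apply H; apply EF; auto.
  - intros p q Hp Hq N H. apply N, left_inj, anti.
    + apply (EF p), H, EF. auto.
    + apply (EF q), H, EF. auto.
Qed.

End Representation.

(** * Reversals *)

Section Reversal.

Context {M : L2_structure} {hM : RCA0 M}.
Implicit Types i j k l m n p q r s t u v w x y z : num M.

(* Every interval representation shifts [p] to the left of [q] at both ends. *)
Definition shifted (le : sets M) p q : Prop :=
  exists r s, strict le r q /\ ~ strict le r p /\ strict le p s /\ ~ strict le q s.

Section Gadget.

Variables P Q : num M -> num M -> Prop.
Hypothesis P_d0 : d0 (fun c : ctx 2 => P (snd (fst c)) (snd c)).
Hypothesis Q_d0 : d0 (fun c : ctx 2 => Q (snd (fst c)) (snd c)).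
Hypothesis disjoint : forall n m m', P n m -> Q n m' -> False.

Variables ka kb kr ks : num M.
Hypothesis kinds : ka <> kb /\ ka <> kr /\ ka <> ks /\ kb <> kr /\ kb <> ks /\ kr <> ks.

(* The element number [m] of kind [k] in the block [n].  The blocks are in
   series.  The elements of kinds [ka] and [kb] are two incomparable elements,
   up to copies; those of kind [kr] and [ks] shift them against each other. *)
Definition el n k m := pair n (pair k m).

(** A witness [m] of [P n] puts the element [m] of kind [kr] below kind [kb] but not [ka], and kind
    [ka] but not [kb] below the element [m] of kind [ks]. This moves [ka] to the left of [kb]; a
    witness of [Q n] does the opposite. *)
Definition local_lt n k m k' m' : Prop :=
  (k = kr /\ k' = ks) \/
  (k = kr /\ k' = kb /\ P n m) \/ (k = kr /\ k' = ka /\ Q n m) \/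
  (k = ka /\ k' = ks /\ P n m') \/ (k = kb /\ k' = ks /\ Q n m').

Definition el_lt x y : Prop :=
  exists n k m n' k' m', x = el n k m /\ y = el n' k' m' /\
    (n < n' \/ (n = n' /\ local_lt n k m k' m')).

Lemma el_inj n k m n' k' m' : el n k m = el n' k' m' -> n = n' /\ k = k' /\ m = m'.
Proof.
  intros E. apply pair_inj in E as [-> E]. apply pair_inj in E as [-> ->]. auto.
Qed.

Lemma el_ltE n k m n' k' m' : el_lt (el n k m) (el n' k' m') <->
  (n < n' \/ (n = n' /\ local_lt n k m k' m')).
Proof.
  split.
  - intros (i & j & l & i' & j' & l' & E & E' & H).
    apply el_inj in E as (<- & <- & <-). apply el_inj in E' as (<- & <- & <-).
    exact H.
  - intros H. exists n, k, m, n', k', m'. auto.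
Qed.

Lemma el_lt_bounded x y : el_lt x y <->
  exists n, n ≤ x /\ exists k, k ≤ x /\ exists m, m ≤ x /\
  exists n', n' ≤ y /\ exists k', k' ≤ y /\ exists m', m' ≤ y /\
    x = el n k m /\ y = el n' k' m' /\
    (n < n' \/ (n = n' /\ local_lt n k m k' m')).
Proof.
  assert (B : forall n k m, n ≤ el n k m /\ k ≤ el n k m /\ m ≤ el n k m).
  { intros n k m. unfold el. split; [apply le_pair_l | split].
    - eapply le_trans; [apply le_pair_l | apply le_pair_r].
    - eapply le_trans; [apply le_pair_r | apply le_pair_r]. }
  split.
  - intros (n & k & m & n' & k' & m' & E & E' & H).
    destruct (B n k m) as (B1 & B2 & B3), (B n' k' m') as (B4 & B5 & B6).
    rewrite <- E in *. rewrite <- E' in *.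
    exists n. split; [auto |]. exists k. split; [auto |]. exists m. split; [auto |].
    exists n'. split; [auto |]. exists k'. split; [auto |]. exists m'. auto.
  - intros (n & _ & k & _ & m & _ & n' & _ & k' & _ & m' & _ & H).
    exists n, k, m, n', k', m'. exact H.
Qed.

Lemma d0_el_lt (i : nat) (s t : @ctx M i -> num M) :
  tm s -> tm t -> d0 (fun c => el_lt (s c) (t c)).
Proof.
  intros Hs Ht. eapply d0_ext; [intros c; apply el_lt_bounded |].
  unfold local_lt, el. definable.
Qed.

Lemma el_lt_irrefl x : ~ el_lt x x.
Proof.
  intros (n & k & m & n' & k' & m' & E & E' & H). rewrite E in E'.
  apply el_inj in E' as (<- & <- & <-). destruct H as [H|[_ H]].
  - exact (lt_irrefl H).
  - unfold local_lt in H. intuition congruence.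
Qed.

Lemma el_lt_trans x y z : el_lt x y -> el_lt y z -> el_lt x z.
Proof.
  intros (n & k & m & n' & k' & m' & -> & -> & H).
  intros (n1 & k1 & m1 & n2 & k2 & m2 & E & -> & K).
  apply el_inj in E as (<- & <- & <-). apply el_ltE.
  destruct H as [H|[<- H]], K as [K|[<- K]]; auto.
  - left. eapply lt_trans; eauto.
  - right. split; auto. unfold local_lt in *. intuition congruence.
Qed.

Lemma el_lt_omits x y z w : el_lt x y -> el_lt z w -> el_lt x w \/ el_lt z y.
Proof.
  intros (n & k & m & n' & k' & m' & -> & -> & H).
  intros (n1 & k1 & m1 & n2 & k2 & m2 & -> & -> & K).
  rewrite !el_ltE.
  assert (L : n ≤ n') by (apply ltS; tauto).
  assert (L1 : n1 ≤ n2) by (apply ltS; tauto).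
  destruct (classic (n < n2)) as [A|A]; [tauto |].
  destruct (classic (n1 < n')) as [B|B]; [tauto |].
  rewrite not_lt in A, B.
  assert (E1 : n = n2).
  { apply le_antisym; auto. eapply le_trans; [exact L |].
    eapply le_trans; [exact B | exact L1]. }
  subst n2.
  assert (E2 : n1 = n).
  { apply le_antisym; [exact L1 | exact (le_trans L B)]. }
  subst n1.
  assert (E3 : n = n') by (apply le_antisym; auto).
  subst n'.
  destruct H as [H|[_ H]]; [destruct (lt_irrefl H) |].
  destruct K as [K|[_ K]]; [destruct (lt_irrefl K) |].
  pose proof (disjoint (n := n)) as D. unfold local_lt in *.
  destruct H as [H|[H|[H|[H|H]]]], K as [K|[K|[K|[K|K]]]];
    first [ solve [left; right; split; [reflexivity |]; intuition congruence]
          | solve [right; right; split; [reflexivity |]; intuition congruence]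
          | exfalso; destruct H as (_ & _ & H), K as (_ & _ & K); eauto ].
Qed.

Lemma gadget_order : exists U le, partial_order U le /\ omits_2_plus_2 U le /\
  (forall x, x ∈ U) /\ (forall x y, strict le x y <-> el_lt x y).
Proof.
  destruct (d0_comprehension (A := fun x => x = x)) as [U HU]; [definable |].
  assert (HU' : forall x, x ∈ U) by (intros x; apply HU; reflexivity).
  destruct (d0_comprehension (A := fun n => exists x, x ≤ n /\ exists y, y ≤ n /\
    n = pair x y /\ (x = y \/ el_lt x y))) as [le Hle].
  { definable. apply d0_el_lt; definable. }
  assert (E : forall x y, rel le x y <-> x = y \/ el_lt x y).
  { intros x y. unfold rel. rewrite Hle. split.
    - intros (x' & _ & y' & _ & E & H). apply pair_inj in E as [<- <-]. exact H.
    - intros H. exists x. split; [apply le_pair_l |]. exists y.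
      split; [apply le_pair_r | auto]. }
  assert (Es : forall x y, strict le x y <-> el_lt x y).
  { intros x y. unfold strict. rewrite E. split; [tauto |]. intros H.
    split; [auto |]. intros ->. exact (el_lt_irrefl H). }
  exists U, le. split; [split; [| split; [| split]] | split; [| split; auto]].
  - intros n Hn. apply Hle in Hn as (x & _ & y & _ & -> & _). exists x, y. auto.
  - intros p _. apply E. auto.
  - intros p q r. rewrite !E. intros [->|H] [<-|K]; auto. right.
    exact (el_lt_trans H K).
  - intros p q. rewrite !E. intros [->|H] [K|K]; auto.
    destruct (el_lt_irrefl (el_lt_trans H K)).
  - intros p0 q0 p1 q1 _ _ _ _. rewrite !Es, !E. intros H K.
    destruct (el_lt_omits H K); auto.
Qed.

Lemma gadget_shift_P le n m : (forall x y, strict le x y <-> el_lt x y) ->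
  P n m -> shifted le (el n ka zero) (el n kb zero).
Proof.
  intros E H. exists (el n kr m), (el n ks m). rewrite !E, !el_ltE.
  pose proof (@lt_irrefl M hM n) as I. pose proof (disjoint H (m' := m)) as D.
  unfold local_lt. intuition congruence.
Qed.

Lemma gadget_shift_Q le n m : (forall x y, strict le x y <-> el_lt x y) ->
  Q n m -> shifted le (el n kb zero) (el n ka zero).
Proof.
  intros E H. exists (el n kr m), (el n ks m). rewrite !E, !el_ltE.
  pose proof (@lt_irrefl M hM n) as I.
  assert (D : ~ P n m) by (intros K; exact (disjoint K H)).
  unfold local_lt. intuition congruence.
Qed.

End Gadget.

Lemma shift_order (A B : num M -> Prop) :
  s1 (fun c : ctx 1 => A (snd c)) -> s1 (fun c : ctx 1 => B (snd c)) ->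
  (forall n, ~ (A n /\ B n)) ->
  exists U le (a b : num M -> num M),
    partial_order U le /\ omits_2_plus_2 U le /\
    (forall x, x ∈ U) /\ (forall n, a n <> b n) /\
    (forall (i : nat) (t : @ctx M i -> num M), tm t -> tm (fun c => a (t c))) /\
    (forall (i : nat) (t : @ctx M i -> num M), tm t -> tm (fun c => b (t c))) /\
    (forall n, A n -> shifted le (a n) (b n)) /\
    (forall n, B n -> shifted le (b n) (a n)).
Proof.
  intros HA HB disj.
  destruct (s1_binary HA) as (P & HP & EP), (s1_binary HB) as (Q & HQ & EQ).
  assert (D : forall n m m', P n m -> Q n m' -> False).
  { intros n m m' H K. apply (disj n). split; [apply EP | apply EQ]; eauto. }
  pose (k1 := @zero M + one). pose (k2 := k1 + one). pose (k3 := k2 + one).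
  assert (kinds : zero <> k1 /\ zero <> k2 /\ zero <> k3 /\
    k1 <> k2 /\ k1 <> k3 /\ k2 <> k3).
  { assert (L1 : zero < k1) by apply le_refl. assert (L2 : k1 < k2) by apply le_refl.
    assert (L3 : k2 < k3) by apply le_refl.
    assert (N : forall x y, x < y -> x <> y) by (intros x y H ->; exact (lt_irrefl H)).
    pose proof (lt_trans L1 L2) as L4. pose proof (lt_trans L2 L3) as L5.
    pose proof (lt_trans L1 L5). auto 10. }
  destruct (gadget_order HP HQ D kinds) as (U & le & H1 & H2 & H3 & E).
  exists U, le, (fun n => el n zero zero), (fun n => el n k1 zero).
  split; [auto | split; [auto | split; [auto | split; [| split; [| split; [| split]]]]]].
  - intros n Eq. apply el_inj in Eq. tauto.
  - intros. unfold el. definable.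
  - intros. unfold el. definable.
  - intros n H. apply EP in H as [m Hm]. exact (gadget_shift_P D kinds E Hm).
  - intros n H. apply EQ in H as [m Hm]. exact (gadget_shift_Q D kinds E Hm).
Qed.

(** * Separating sets from representations *)

(** The separating set asks whether the left endpoint of [a n] precedes that of [b n]. As [f0] is a
    function, both answers are [s1]. *)
Lemma closed_separation :
  (forall P le : sets M, partial_order P le -> omits_2_plus_2 P le ->
    closed_interval_order P le) -> separation M.
Proof.
  intros rep A B HA HB disj.
  destruct (shift_order HA HB disj)
    as (U & le & a & b & HU & Hom & inU & _ & ta & tb & SA & SB).
  destruct (rep U le HU Hom) as (L & leL & f0 & f1 & Hlin & F0 & F1 & C1 & C2).
  destruct Hlin as [(_ & refl & trans & anti) total].
  assert (ex0 : forall p, exists x, x ∈ L /\ rel f0 p x).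
  { intros p. destruct (proj2 F0 p (inU p)) as (x & Hx & _). exists x.
    split; auto. apply (proj1 F0) in Hx as (i & j & _ & Hj & E).
    apply pair_inj in E as [_ ->]. exact Hj. }
  assert (ex1 : forall p, exists x, x ∈ L /\ rel f1 p x).
  { intros p. destruct (proj2 F1 p (inU p)) as (x & Hx & _). exists x.
    split; auto. apply (proj1 F1) in Hx as (i & j & _ & Hj & E).
    apply pair_inj in E as [_ ->]. exact Hj. }
  (* The right endpoint [z] of [r] lies between: [x] is at most [z], and [z] is strictly before
     [y]. *)
  assert (shift : forall p q x y, shifted le p q -> rel f0 p x -> rel f0 q y ->
    strict leL x y).
  { intros p q x y (r & _ & H & N & _) Hx Hy.
    destruct (ex1 r) as (z & Lz & Hz). destruct (ex0 p) as (x' & Lx & Hx').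
    assert (E : x = x').
    { destruct (proj2 F0 p (inU p)) as (u & _ & Hu).
      rewrite <- (Hu x Hx). auto. }
    subst x'. apply (C2 r q z y) in H as [H H']; auto.
    assert (K : rel leL x z).
    { destruct (total x z Lx Lz) as [K|K]; [exact K |].
      destruct (classic (z = x)) as [->|Nz]; auto.
      destruct N. apply (C2 r p z x); auto. split; auto. }
    split; [eauto |]. intros ->. apply H', anti; auto. }
  destruct (reduction
    (A := fun n => exists x, exists y,
      rel f0 (a n) x /\ rel f0 (b n) y /\ strict leL x y)
    (B := fun n => exists x, exists y,
      rel f0 (a n) x /\ rel f0 (b n) y /\ ~ strict leL x y)) as [X HX].
  - do 2 apply s1_ex. apply s1_d0. unfold strict.
    definable; first [apply ta | apply tb]; definable.
  - do 2 apply s1_ex. apply s1_d0. unfold strict.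
    definable; first [apply ta | apply tb]; definable.
  - intros n. destruct (ex0 (a n)) as (x & _ & Hx), (ex0 (b n)) as (y & _ & Hy).
    destruct (classic (strict leL x y)); [left | right]; exists x, y; auto.
  - exists X. intros n. split; intros H.
    + apply NNPP. intros N. apply HX in N as (x & y & Hx & Hy & N).
      apply N. apply (shift (a n) (b n)); auto.
    + intros N. apply HX in N as (x & y & Hx & Hy & N & N').
      destruct (shift (b n) (a n) y x) as [K _]; auto.
Qed.

(** Intervals have no endpoints to compare, but distinct ones differ at some point. The side on
    which this point lies of a point of the other interval gives a direction, and [reduction]
    chooses one for each [n]. *)
Lemma one_one_separation :
  (forall P le : sets M, partial_order P le -> omits_2_plus_2 P le ->
    one_one_interval_order P le) -> separation M.
Proof.
  intros rep A B HA HB disj.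
  destruct (shift_order HA HB disj)
    as (U & le & a & b & HU & Hom & inU & ab & ta & tb & SA & SB).
  destruct (rep U le HU Hom)
    as (L & leL & F & ((HleL & total) & Fon & Hconv & HF) & Hdist).
  destruct HleL as (_ & refl & trans & anti).
  assert (FL : forall p x, rel F p x -> x ∈ L).
  { intros p x Hx. apply Fon in Hx as (i & j & _ & Hj & E).
    apply pair_inj in E as [_ ->]. exact Hj. }
  assert (tri : forall x y, x ∈ L -> y ∈ L -> strict leL x y \/ rel leL y x).
  { intros x y Hx Hy. destruct (classic (x = y)) as [->|N]; [auto |].
    unfold strict. destruct (total x y Hx Hy); auto. }
  assert (lt_le : forall x y z, strict leL x y -> rel leL y z -> strict leL x z).
  { intros x y z [H N] K. split; [eauto |]. intros ->. apply N, anti; auto. }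
  assert (le_lt : forall x y z, rel leL x y -> strict leL y z -> strict leL x z).
  { intros x y z K [H N]. split; [eauto |]. intros ->. apply N, anti; auto. }
  pose (leftwards p q := exists x, exists y,
    (rel F p x /\ ~ rel F q x /\ rel F q y /\ strict leL x y) \/
    (rel F q x /\ ~ rel F p x /\ rel F p y /\ strict leL y x)).
  assert (leftwards_total : forall p q, p <> q -> leftwards p q \/ leftwards q p).
  { enough (K : forall p q x, rel F p x -> ~ rel F q x ->
      leftwards p q \/ leftwards q p).
    { intros p q N. apply NNPP. intros H. apply (Hdist p q); auto.
      intros x. split; intros Hx; apply NNPP; intros Nx; apply H;
        [| apply or_comm]; eauto. }
    intros p q x Hx Nx. destruct (proj1 (Hconv q (inU q))) as [y Hy].
    assert (N : x <> y) by (intros ->; tauto).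
    destruct (total x y (FL _ _ Hx) (FL _ _ Hy)) as [K|K]; [left | right];
      exists x, y; [left | right]; repeat (split; auto). }
  (* In the first case a point of [p] not to the right of some point of [r] would lie before [x],
     and convexity would put [x] into the interval of [p]; so [r] is below [p], a contradiction. The
     second case is its mirror image, with [s]. *)
  assert (shift : forall p q, shifted le p q -> ~ leftwards q p).
  { intros p q (r & s & H1 & H2 & H3 & H4) (x & y & [(Hx & Nx & Hy & K)|(Hx & Nx & Hy & K)]).
    - apply H2, HF; auto. intros u v Hu Hv.
      destruct (tri u v) as [T|T]; eauto. exfalso. apply Nx.
      apply (proj2 (Hconv p (inU p)) v y x); auto.
      apply (le_lt _ u); auto. apply (proj1 (HF r q (inU r) (inU q))); auto.
    - apply H4, HF; auto. intros u v Hu Hv.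
      destruct (tri u v) as [T|T]; eauto. exfalso. apply Nx.
      apply (proj2 (Hconv q (inU q)) y u x); auto.
      apply (lt_le _ v); auto. apply (proj1 (HF p s (inU p) (inU s))); auto. }
  destruct (reduction (A := fun n => leftwards (a n) (b n))
    (B := fun n => leftwards (b n) (a n))) as [X HX].
  - do 2 apply s1_ex. apply s1_d0. unfold strict.
    definable; first [apply ta | apply tb]; definable.
  - do 2 apply s1_ex. apply s1_d0. unfold strict.
    definable; first [apply ta | apply tb]; definable.
  - intros n. apply leftwards_total, ab.
  - exists X. intros n. split; intros H.
    + apply NNPP. intros N. apply HX in N. exact (shift _ _ (SA n H) N).
    + intros N. apply HX in N. exact (shift _ _ (SB n H) N).
Qed.

(** * Implications between the notions, and omission of 2+2 *)

Lemma distinguishing_one_one_closed (P le : sets M) :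
  distinguishing_interval_order P le -> one_one_closed_interval_order P le.
Proof.
  intros (L & leL & f0 & f1 & Hrep & H). exists L, leL, f0, f1.
  split; [exact Hrep |]. intros p q x0 x1 y0 y1 Hp Hq N H0 _ K0 _. left.
  apply (H false false p q); auto.
Qed.

Lemma one_one_closed_closed (P le : sets M) :
  one_one_closed_interval_order P le -> closed_interval_order P le.
Proof.
  intros (L & leL & f0 & f1 & Hrep & _). exists L, leL, f0, f1. exact Hrep.
Qed.

(** The smaller of the two right endpoints precedes both left endpoints. *)
Lemma closed_omits (P le : sets M) :
  closed_interval_order P le -> omits_2_plus_2 P le.
Proof.
  intros (L & leL & f0 & f1 & Hlin & F0 & F1 & C1 & C2).
  destruct Hlin as [(_ & refl & trans & anti) total].
  intros p0 q0 p1 q1 Hp0 Hq0 Hp1 Hq1 H0 H1.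
  destruct (proj2 F1 p0 Hp0) as (x0 & X0 & _).
  destruct (proj2 F1 p1 Hp1) as (x1 & X1 & _).
  destruct (proj2 F0 q0 Hq0) as (y0 & Y0 & _).
  destruct (proj2 F0 q1 Hq1) as (y1 & Y1 & _).
  apply (C2 p0 q0 x0 y0) in H0 as [H0 N0]; auto.
  apply (C2 p1 q1 x1 y1) in H1 as [H1 N1]; auto.
  assert (inL : forall p x, rel f1 p x -> x ∈ L).
  { intros p x Hx. apply (proj1 F1) in Hx as (i & j & _ & Hj & E).
    apply pair_inj in E as [_ ->]. exact Hj. }
  destruct (total x0 x1) as [K|K]; eauto.
  - left. apply (C2 p0 q1 x0 y1); auto. split; [eauto |].
    intros ->. apply N1, anti; auto.
  - right. apply (C2 p1 q0 x1 y0); auto. split; [eauto |].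
    intros ->. apply N0, anti; auto.
Qed.

(** If both conclusions failed, points of the four intervals would form a cycle: [x] before [y'], at
    most [x'], before [y], at most [x]. *)
Lemma one_one_omits (P le : sets M) :
  one_one_interval_order P le -> omits_2_plus_2 P le.
Proof.
  intros (L & leL & F & ((HleL & total) & Fon & _ & HF) & _).
  destruct HleL as (_ & refl & trans & anti).
  intros p0 q0 p1 q1 Hp0 Hq0 Hp1 Hq1 H0 H1.
  assert (FL : forall p x, rel F p x -> x ∈ L).
  { intros p x Hx. apply Fon in Hx as (i & j & _ & Hj & E).
    apply pair_inj in E as [_ ->]. exact Hj. }
  apply NNPP. intros N.
  assert (K : forall p q, p ∈ P -> q ∈ P -> ~ rel le p q ->
    exists x y, rel F p x /\ rel F q y /\ rel leL y x).
  { intros p q Hp Hq Npq. apply NNPP. intros H. apply Npq.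
    enough (S : strict le p q) by apply S. apply HF; auto. intros x y Hx Hy.
    destruct (total y x (FL _ _ Hy) (FL _ _ Hx)) as [T|T]; [destruct H; eauto |].
    split; auto. intros ->. apply H. eauto. }
  destruct (K p0 q1) as (x & y & Hx & Hy & T); auto.
  destruct (K p1 q0) as (x' & y' & Hx' & Hy' & T'); auto.
  destruct (proj1 (HF p0 q0 Hp0 Hq0) H0 x y' Hx Hy') as [S _].
  destruct (proj1 (HF p1 q1 Hp1 Hq1) H1 x' y Hx' Hy) as [S' N'].
  apply N', anti; eauto.
Qed.

End Reversal.

Theorem theorem1p2 (M : L2_structure) (hM : RCA0 M) :
  (WKL M <-> characterized_by_omitting_2_plus_2 (@one_one_interval_order M)) /\
  (WKL M <-> characterized_by_omitting_2_plus_2 (@closed_interval_order M)) /\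
  (WKL M <-> characterized_by_omitting_2_plus_2 (@one_one_closed_interval_order M)) /\
  (WKL M <-> characterized_by_omitting_2_plus_2 (@distinguishing_interval_order M)).
Proof.
  pose proof (@distinguishing_one_one_closed M) as DC.
  pose proof (@one_one_closed_closed M) as CC.
  pose proof (@closed_omits M hM) as CO.
  (* Among the three notions with endpoints, the distinguishing one is the strongest and the closed
     one the weakest; so representations are built for the former and the reversal starts from the
     latter. *)
  assert (D : WKL M -> forall P le : sets M, partial_order P le ->
    omits_2_plus_2 P le -> distinguishing_interval_order P le).
  { intros wkl. apply separation_distinguishing, WKL_separation, wkl. }
  assert (W : (forall P le : sets M, partial_order P le -> omits_2_plus_2 P le ->
    closed_interval_order P le) -> WKL M).
  { intros H. apply separation_WKL, closed_separation, H. }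
  split; [| split; [| split]]; split.
  - intros wkl P le HP. split; [apply one_one_omits |].
    apply separation_one_one; [apply WKL_separation, wkl | exact HP].
  - intros H. apply separation_WKL, one_one_separation. intros P le HP.
    apply H, HP.
  - intros wkl P le HP. split; auto.
  - intros H. apply W. intros P le HP. apply H, HP.
  - intros wkl P le HP. split; auto.
  - intros H. apply W. intros P le HP Hom. apply CC, H; auto.
  - intros wkl P le HP. split; auto.
  - intros H. apply W. intros P le HP Hom. apply CC, DC, H; auto.
Qed.
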